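(* Let $k$ be a unital commutative ring and $G$ a group. The cotorsion pair $\left({\tt Cof}(kG),{\tt Cof}(kG)^{\perp}\right)$ in the category of $kG$-modules is hereditary and projective.
   Context: The tensor product $M\otimes_k N$ of two $kG$-modules is a $kG$-module with the diagonal action $g(x\otimes y)=gx\otimes gy$. Let $B=B(G,k)$ be the $kG$-module of all functions $G\to k$ taking only finitely many values, with action $(g\cdot f)(x)=f(g^{-1}x)$. A $kG$-module $M$ is cofibrant if the diagonal $kG$-module $M\otimes_k B$ is projective; ${\tt Cof}(kG)$ is the class of cofibrant $kG$-modules. For a class ${\tt S}$ of modules over a ring $R$, ${\tt S}^{\perp}$ is the class of modules $N$ with ${\rm Ext}^1_R(S,N)=0$ for all $S\in{\tt S}$, and $^{\perp}{\tt S}$ is the class of modules $M$ with ${\rm Ext}^1_R(M,S)=0$ for all $S\in{\tt S}$. A pair $({\tt U},{\tt V})$ is a cotorsion pair if ${\tt U}={}^{\perp}{\tt V}$ and ${\tt U}^{\perp}={\tt V}$. It is hereditary if ${\rm Ext}^i_R(U,V)=0$ for all $i>0$, $U\in{\tt U}$, $V\in{\tt V}$. It is projective if ${\tt U}\cap{\tt V}$ is the class of projective modules. *)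

(* Defs.v *)
From HB Require Import structures.
From mathcomp Require Import all_boot all_algebra.
From mathcomp Require Import boolp classical_sets functions cardinality.
From mathcomp Require Import finmap.
From mathcomp.multinomials Require Import monalg.

Set Implicit Arguments.
Unset Strict Implicit.
Unset Printing Implicit Defensive.

Import GRing.Theory.
Local Open Scope quotient_scope.
Local Open Scope classical_set_scope.
Local Open Scope ring_scope.

Section MalgLift.
Context {X : choiceType} {A V : zmodType}.
Implicit Types (a b : {malg A[X]}) (f : X -> A -> V).

(* The additive extension of [<< u *g x >> |-> f x u]. *)
Definition malg_lift f a : V := \sum_(x <- msupp a) f x a@_x.

Lemma malg_liftw f a (D : {fset X}) : (forall x, f x 0 = 0) ->
  (msupp a `<=` D)%fset -> malg_lift f a = \sum_(x <- D) f x a@_x.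
Proof.
move=> f0 sD; rewrite /malg_lift; apply: big_fset_incl => // x _.
by move=> /mcoeff_outdom ->; rewrite f0.
Qed.

Lemma malg_liftU f x u : (forall x, f x 0 = 0) ->
  malg_lift f << u *g x >> = f x u.
Proof.
move=> f0; rewrite (malg_liftw f0 msuppU_le) big_seq_fset1.
by rewrite mcoeffUU.
Qed.

Lemma malg_liftD f : (forall x, {morph f x : u v / u + v}) ->
  {morph malg_lift f : a b / a + b}.
Proof.
move=> fD a b.
have f0 x : f x 0 = 0 by apply: (addrI (f x 0)); rewrite -fD !addr0.
rewrite (malg_liftw f0 (msuppD_le a b)).
rewrite (malg_liftw f0 (fsubsetUl (msupp a) (msupp b))).
rewrite (malg_liftw f0 (fsubsetUr (msupp a) (msupp b))).
by rewrite -big_split; apply: eq_bigr => x _; rewrite mcoeffD fD.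
Qed.

Lemma malg_ind (P : {malg A[X]} -> Prop) : P 0 ->
  (forall a b, P a -> P b -> P (a + b)) ->
  (forall x u, P << u *g x >>) -> forall a, P a.
Proof.
by move=> P0 PD PU a; rewrite (monalgE a); elim/big_ind: _ => // x _; apply: PU.
Qed.

End MalgLift.

Lemma morphD0 (U V : zmodType) (f : U -> V) :
  {morph f : x y / x + y} -> f 0 = 0.
Proof. by move=> fD; apply: (addrI (f 0)); rewrite -fD !addr0. Qed.

Definition free_module (R : pzRingType) (X : choiceType) : Type := {malg R[X]}.

Section FreeModule.
Context {R : pzRingType} {X : choiceType}.
Local Notation F := (free_module R X).

HB.instance Definition _ := GRing.Zmodule.copy F {malg R[X]}.

Lemma free_ind (P : F -> Prop) : P 0 ->
  (forall a b, P a -> P b -> P (a + b)) ->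
  (forall x u, P << u *g x >>) -> forall a, P a.
Proof. exact: malg_ind. Qed.

Definition free_gen (x : X) : F := << (1 : R) *g x >>.

Definition free_scale (c : R) (a : F) : F :=
  malg_lift (fun x u => << c * u *g x >>) a.

Lemma free_scaleU c x u :
  free_scale c << u *g x >> = << c * u *g x >> :> {malg R[X]}.
Proof. by rewrite /free_scale malg_liftU // => y; rewrite mulr0 monalgU0. Qed.

Lemma free_scaleDr : right_distributive free_scale +%R.
Proof.
by move=> c; apply: malg_liftD => x u v; rewrite mulrDr monalgUD.
Qed.

Lemma free_scale0r c : free_scale c 0 = 0.
Proof. exact: (morphD0 (free_scaleDr c)). Qed.

Lemma free_scaleDl a : {morph free_scale^~ a : c d / c + d}.
Proof.
move=> c d; elim/free_ind: a => [|a b IHa IHb|x u].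
- by rewrite !free_scale0r addr0.
- by rewrite !free_scaleDr IHa IHb addrACA.
- by rewrite !free_scaleU mulrDl monalgUD.
Qed.

Lemma free_scaleA c d a : free_scale c (free_scale d a) = free_scale (c * d) a.
Proof.
elim/free_ind: a => [|a b IHa IHb|x u].
- by rewrite !free_scale0r.
- by rewrite !free_scaleDr IHa IHb.
- by rewrite !free_scaleU mulrA.
Qed.

Lemma free_scale1 : left_id 1 free_scale.
Proof.
elim/free_ind => [|a b IHa IHb|x u].
- by rewrite !free_scale0r.
- by rewrite !free_scaleDr IHa IHb.
- by rewrite !free_scaleU mul1r.
Qed.

HB.instance Definition _ := GRing.Zmodule_isLmodule.Build R F
  free_scaleA free_scale1 free_scaleDr free_scaleDl.

Lemma scale_malgU (c u : R) (x : X) : c *: (<< u *g x >> : F) = << c * u *g x >>.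
Proof. exact: free_scaleU. Qed.

Lemma free_genE (x : X) (u : R) : << u *g x >> = u *: free_gen x.
Proof. by rewrite scale_malgU mulr1. Qed.

Section Extend.
Context {M : lmodType R} (f : X -> M).

Definition free_lift (a : F) : M := malg_lift (fun x u => u *: f x) a.

Lemma free_lift_linear : linear free_lift.
Proof.
have fD : {morph free_lift : a b / a + b}.
  by apply: malg_liftD => x u v; rewrite scalerDl.
have fU x u : free_lift << u *g x >> = u *: f x.
  by rewrite /free_lift malg_liftU // => y; rewrite scale0r.
move=> c a b; rewrite fD; congr (_ + _).
elim/free_ind: a => [|a1 a2 IH1 IH2|x u].
- by rewrite scaler0 (morphD0 fD) scaler0.
- by rewrite scalerDr !fD scalerDr IH1 IH2.
- by rewrite scale_malgU !fU scalerA.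
Qed.

HB.instance Definition _ := GRing.isLinear.Build R F M *:%R free_lift
  free_lift_linear.

Lemma free_lift_gen x : free_lift (free_gen x) = f x.
Proof.
by rewrite /free_lift malg_liftU ?scale1r // => y; rewrite scale0r.
Qed.

End Extend.

Lemma free_linear_ext (M : lmodType R) (f g : {linear F -> M}) :
  (forall x, f (free_gen x) = g (free_gen x)) -> f =1 g.
Proof.
move=> fg; elim/free_ind => [|a b IHa IHb|x u].
- by rewrite !linear0.
- by rewrite !linearD IHa IHb.
- by rewrite free_genE !linearZ fg.
Qed.

End FreeModule.

Section Span.
Context {R : pzRingType} {M : lmodType R}.

Inductive span (A : set M) : set M :=
| span_gen x of A x : span A x
| span_zero : span A 0
| span_lin c x y of span A x & span A y : span A (c *: x + y).

Definition spanb (A : set M) : {pred M} := fun x => `[< span A x >].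

Lemma spanb_closed A : submod_closed (spanb A).
Proof.
split=> [|c x y]; first by apply/asboolP; apply: span_zero.
by move=> /asboolP xA /asboolP yA; apply/asboolP; apply: span_lin.
Qed.

HB.instance Definition _ A :=
  GRing.isSubmodClosed.Build R M (spanb A) (spanb_closed A).

End Span.

(* The quotient of [M] by the submodule generated by [A]. *)
Definition quot_module (R : pzRingType) (M : lmodType R) (A : set M) : Type :=
  Quotient.quot (spanb A).

Section QuotModule.
Context {R : pzRingType} {M : lmodType R} {A : set M}.
Local Notation Q := (quot_module A).

HB.instance Definition _ := GRing.Zmodule.copy Q (Quotient.quot (spanb A)).

Definition quot_pi (x : M) : Q := \pi_(Quotient.quot (spanb A)) x.
Definition quot_repr (q : Q) : M := repr (q : Quotient.quot (spanb A)).

Lemma quot_reprK : cancel quot_repr quot_pi.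
Proof. by move=> q; rewrite /quot_pi /quot_repr reprK. Qed.

Lemma quot_eqP x y : quot_pi x = quot_pi y <-> x - y \in spanb A.
Proof.
rewrite /quot_pi Quotient.idealrBE; split=> [/eqP //|/eqP //].
Qed.

Lemma quot_piD : {morph quot_pi : x y / x + y}.
Proof. by move=> x y; rewrite /quot_pi piE. Qed.

Definition quot_scale (c : R) (q : Q) : Q := quot_pi (c *: quot_repr q).

Lemma quot_scale_pi c x : quot_scale c (quot_pi x) = quot_pi (c *: x).
Proof.
by apply/quot_eqP; rewrite -scalerBr rpredZ //; apply/quot_eqP; rewrite quot_reprK.
Qed.

Lemma quot_scaleA c d q : quot_scale c (quot_scale d q) = quot_scale (c * d) q.
Proof. by rewrite -[q]quot_reprK !quot_scale_pi scalerA. Qed.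

Lemma quot_scale1 : left_id 1 quot_scale.
Proof. by move=> q; rewrite -[q]quot_reprK quot_scale_pi scale1r. Qed.

Lemma quot_scaleDr : right_distributive quot_scale +%R.
Proof.
move=> c p q; rewrite -[p]quot_reprK -[q]quot_reprK.
by rewrite -quot_piD !quot_scale_pi scalerDr quot_piD.
Qed.

Lemma quot_scaleDl q : {morph quot_scale^~ q : c d / c + d}.
Proof.
by move=> c d; rewrite -[q]quot_reprK !quot_scale_pi scalerDl quot_piD.
Qed.

HB.instance Definition _ := GRing.Zmodule_isLmodule.Build R Q
  quot_scaleA quot_scale1 quot_scaleDr quot_scaleDl.

Lemma quot_pi_linear : linear quot_pi.
Proof. by move=> c x y; rewrite quot_piD -quot_scale_pi. Qed.

HB.instance Definition _ := GRing.isLinear.Build R M Q *:%R quot_pi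
  quot_pi_linear.

End QuotModule.

Section Kernel.
Context {R : pzRingType} {M N : lmodType R} (f : {linear M -> N}).

Definition kerb : {pred M} := fun x => f x == 0.

Lemma kerb_closed : submod_closed kerb.
Proof.
split=> [|c x y]; rewrite /in_mem /= /kerb ?linear0 //.
by move=> /eqP fx /eqP fy; rewrite linearP fx fy scaler0 addr0.
Qed.

HB.instance Definition _ := GRing.isSubmodClosed.Build R M kerb kerb_closed.

Record kernel := Kernel { kernel_val :> M; kernelP : kernel_val \in kerb }.

HB.instance Definition _ := [isSub for kernel_val].
HB.instance Definition _ := [Choice of kernel by <:].
HB.instance Definition _ := [SubChoice_isSubLmodule of kernel by <:].

End Kernel.

Section Ext.
Context {R : pzRingType}.
Implicit Types M N : lmodType R.

Definition surj (X Y : Type) (f : X -> Y) := forall y, exists x, f x = y.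

Definition projective_module (P : lmodType R) : Prop :=
  forall M N (p : {linear M -> N}) (f : {linear P -> N}), surj p ->
    exists g : {linear P -> M}, forall x, p (g x) = f x.

Record proj_resolution M := ProjResolution {
  res_mod : nat -> lmodType R;
  res_diff : forall n, {linear res_mod n.+1 -> res_mod n};
  res_aug : {linear res_mod 0 -> M};
  res_proj : forall n, projective_module (res_mod n);
  res_aug_surj : surj res_aug;
  res_exact0 : forall x : res_mod 0, res_aug x = 0 <-> range (res_diff 0) x;
  res_exact : forall n (x : res_mod n.+1),
    res_diff n x = 0 <-> range (res_diff n.+1) x
}.

Lemma free_projective (X : choiceType) : projective_module (free_module R X).
Proof.
move=> M N p f p_surj.
have [s sP] := choice (fun x => p_surj (f (free_gen x))).
exists (free_lift s); apply: (@free_linear_ext _ _ _ (p \o free_lift s) f) => x.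
by rewrite /= free_lift_gen sP.
Qed.

(* The standard free resolution: each syzygy is covered by the free module on
   its underlying set. *)
Definition free_cover M : {linear free_module R M -> M} := free_lift id.

Lemma free_cover_surj M : surj (free_cover M).
Proof. by move=> y; exists (free_gen y); rewrite /free_cover /= free_lift_gen. Qed.

Fixpoint syzygy (n : nat) M : lmodType R :=
  if n is m.+1 then kernel (free_cover (syzygy m M)) else M.

Definition std_mod M n : lmodType R := free_module R (syzygy n M).

Definition std_diff M n : {linear std_mod M n.+1 -> std_mod M n} :=
  (val : kernel (free_cover (syzygy n M)) -> std_mod M n)
    \o free_cover (syzygy n.+1 M).

Lemma std_range M n (x : std_mod M n) :
  free_cover (syzygy n M) x = 0 <-> range (std_diff M n) x.
Proof.
split=> [/eqP x0|[y _ <-]]; last exact/eqP/(kernelP (free_cover _ y)).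
have [y yx] := @free_cover_surj (syzygy n.+1 M) (Kernel x0).
by exists y => //; rewrite /= yx.
Qed.

Lemma std_exact M n (x : std_mod M n.+1) :
  std_diff M n x = 0 <-> range (std_diff M n.+1) x.
Proof.
rewrite -std_range; split=> [x0|x0]; first exact: val_inj.
by rewrite /std_diff /= x0.
Qed.

Definition std_resolution M : proj_resolution M :=
  ProjResolution (fun n => @free_projective (syzygy n M)) (@free_cover_surj M)
    (@std_range M 0) (@std_exact M).

Section Cocycles.
Variables (M : lmodType R) (P : proj_resolution M) (N : lmodType R) (n : nat).

(* [Hom_R(P_n, N)] is the group of linear maps, inside the group of all
   functions from [P_n] to [N]. *)
Definition cocycleb : {pred (res_mod P n -> N)} :=
  fun f => `[< linear f /\ forall x, f (res_diff P n x) = 0 >].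

Lemma cocycleb_closed : zmod_closed cocycleb.
Proof.
split=> [|f g].
  by apply/asboolP; split=> // c x y; rewrite /= scaler0 addr0.
move=> /asboolP[fl f0] /asboolP[gl g0]; apply/asboolP; split=> [c x y|x].
  by rewrite !fctE fl gl scalerBr opprD addrACA.
by rewrite !fctE f0 g0 subrr.
Qed.

HB.instance Definition _ :=
  GRing.isZmodClosed.Build (res_mod P n -> N) cocycleb cocycleb_closed.

Record cocycle :=
  Cocycle { cocycle_fun :> res_mod P n -> N; cocycleP : cocycle_fun \in cocycleb }.

HB.instance Definition _ := [isSub for cocycle_fun].
HB.instance Definition _ := [Choice of cocycle by <:].
HB.instance Definition _ := [SubChoice_isSubZmodule of cocycle by <:].

End Cocycles.

Definition is_coboundary M (P : proj_resolution M) N n :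
    (res_mod P n -> N) -> Prop :=
  match n with
  | 0 => fun f => f = 0
  | m.+1 => fun f => exists g : {linear res_mod P m -> N},
                       forall x, f x = g (res_diff P m x)
  end.

Lemma is_coboundary0 M (P : proj_resolution M) N n :
  is_coboundary (0 : res_mod P n -> N).
Proof. by case: n => [|m] //=; exists \0. Qed.

Lemma is_coboundaryB M (P : proj_resolution M) N n (f g : res_mod P n -> N) :
  is_coboundary f -> is_coboundary g -> is_coboundary (f - g).
Proof.
case: n f g => [|m] f g /=; first by move=> -> ->; rewrite subrr.
move=> [f' ff'] [g' gg']; exists (f' \- g') => x.
by rewrite -[LHS]/(f x - g x) ff' gg'.
Qed.

Section HomCohomology.
Variables (M : lmodType R) (P : proj_resolution M) (N : lmodType R) (n : nat).

Definition coboundaryb : {pred cocycle P N n} :=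
  fun f => `[< is_coboundary (cocycle_fun f) >].

Lemma coboundaryb_closed : zmod_closed coboundaryb.
Proof.
split=> [|f g].
  by apply/asboolP; apply: is_coboundary0.
by move=> /asboolP fb /asboolP gb; apply/asboolP; apply: is_coboundaryB.
Qed.

HB.instance Definition _ :=
  GRing.isZmodClosed.Build (cocycle P N n) coboundaryb coboundaryb_closed.

(* [H^n(Hom_R(P, N))] *)
Definition hom_cohomology : zmodType := Quotient.quot coboundaryb.

End HomCohomology.

(* Ext computed from the standard resolution. *)
Definition Ext (n : nat) M N : zmodType :=
  hom_cohomology (std_resolution M) N n.

Definition Ext_vanishes n M N : Prop := forall x : Ext n M N, x = 0.

Definition module_class := lmodType R -> Prop.
Implicit Types S U V : module_class.

Definition right_perp S : module_class :=
  fun N => forall M, S M -> Ext_vanishes 1 M N.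

Definition left_perp S : module_class :=
  fun M => forall N, S N -> Ext_vanishes 1 M N.

Definition cotorsion_pair U V : Prop :=
  (forall M, U M <-> left_perp V M) /\ (forall N, right_perp U N <-> V N).

Definition hereditary U V : Prop :=
  forall i, (0 < i)%N -> forall M N, U M -> V N -> Ext_vanishes i M N.

Definition projective_pair U V : Prop :=
  forall M, U M /\ V M <-> projective_module M.

End Ext.

(* [{malg k[G]}] as a bare group; the ring structure that the library
   puts on it asks for a nonzero ring and excludes monoids with inverses. *)
Definition group_ring (k : comPzRingType) (G : groupType) : Type := {malg k[G]}.

Section GroupRing.
Context {k : comPzRingType} {G : groupType}.
Local Notation kG := (group_ring k G).

HB.instance Definition _ := GRing.Zmodule.copy kG {malg k[G]}.

Lemma gr_ind (P : kG -> Prop) : P 0 ->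
  (forall a b, P a -> P b -> P (a + b)) ->
  (forall g u, P << u *g g >>) -> forall a, P a.
Proof. exact: malg_ind. Qed.

Definition gr_one : kG := << (1 : k) *g (1%g : G) >>.

Definition gr_mul (a b : kG) : kG :=
  malg_lift (fun g u => malg_lift (fun h v => << u * v *g (g * h)%g >>) b) a.

Let mul1 (b : kG) (g : G) (u : k) : kG :=
  malg_lift (fun h v => << u * v *g (g * h)%g >>) b.

Let mul1U g u h v : mul1 << v *g h >> g u = << u * v *g (g * h)%g >>.
Proof. by rewrite /mul1 malg_liftU // => x; rewrite mulr0 monalgU0. Qed.

Let mul1Dr g u : {morph mul1^~ g ^~ u : a b / a + b}.
Proof. by apply: malg_liftD => h v w; rewrite mulrDr monalgUD. Qed.

Let mul1Dl b g : {morph mul1 b g : u v / u + v}.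
Proof.
move=> u v; elim/gr_ind: b => [|a b IHa IHb|h w].
- by rewrite !(morphD0 (mul1Dr _ _)) addr0.
- by rewrite !mul1Dr IHa IHb addrACA.
- by rewrite !mul1U mulrDl monalgUD.
Qed.

Lemma gr_mulDl : left_distributive gr_mul +%R.
Proof. by move=> a b c; apply: malg_liftD => g; apply: mul1Dl. Qed.

Lemma gr_mulUl g u b : gr_mul << u *g g >> b = mul1 b g u.
Proof. by rewrite /gr_mul malg_liftU // => x; apply: (morphD0 (mul1Dl b x)). Qed.

Lemma gr_mulU g u h v :
  gr_mul << u *g g >> << v *g h >> = << u * v *g (g * h)%g >>.
Proof. by rewrite gr_mulUl mul1U. Qed.

Let mul0l a : gr_mul 0 a = 0.
Proof. exact: (morphD0 (fun x y => gr_mulDl x y a)). Qed.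

Lemma gr_mulDr : right_distributive gr_mul +%R.
Proof.
move=> a b c; elim/gr_ind: a => [|a a' IHa IHb|g u].
- by rewrite !mul0l addr0.
- by rewrite !gr_mulDl IHa IHb addrACA.
- by rewrite !gr_mulUl mul1Dr.
Qed.

Let mul0r a : gr_mul a 0 = 0. Proof. exact: (morphD0 (gr_mulDr a)). Qed.

Lemma gr_mulA : associative gr_mul.
Proof.
move=> a b c; elim/gr_ind: a => [|a a' IHa IHb|g u].
- by rewrite !mul0l.
- by rewrite !gr_mulDl IHa IHb.
elim/gr_ind: b => [|b b' IHa IHb|h v].
- by rewrite mul0r !mul0l mul0r.
- by rewrite gr_mulDl !gr_mulDr gr_mulDl IHa IHb.
elim/gr_ind: c => [|c c' IHa IHb|l w].
- by rewrite !mul0r.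
- by rewrite !gr_mulDr IHa IHb.
- by rewrite !gr_mulU mulrA mulgA.
Qed.

Lemma gr_mul1l : left_id gr_one gr_mul.
Proof.
elim/gr_ind => [|a b IHa IHb|g u].
- exact: mul0r.
- by rewrite gr_mulDr IHa IHb.
- by rewrite gr_mulU mul1r mul1g.
Qed.

Lemma gr_mul1r : right_id gr_one gr_mul.
Proof.
elim/gr_ind => [|a b IHa IHb|g u].
- exact: mul0l.
- by rewrite gr_mulDl IHa IHb.
- by rewrite gr_mulU mulr1 mulg1.
Qed.

HB.instance Definition _ := GRing.Zmodule_isPzRing.Build kG
  gr_mulA gr_mul1l gr_mul1r gr_mulDl gr_mulDr.

Definition gr_scalar (c : k) : kG := << c *g (1%g : G) >>.
Definition gr_elt (g : G) : kG := << (1 : k) *g g >>.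

End GroupRing.

(* A [k]-module with a [k]-linear action of [G]. [rep_module] below turns it
   into a module over the group algebra, and [module_rep] goes back: [c : k] acts
   as [c *: 1] and [g : G] as the basis element [g]. *)
Record rep (k : comPzRingType) (G : groupType) := Rep {
  rep_space :> lmodType k;
  rep_act : G -> rep_space -> rep_space;
  rep_linear : forall g, linear (rep_act g);
  rep_act1 : forall x, rep_act 1%g x = x;
  rep_actM : forall g h x, rep_act (g * h)%g x = rep_act g (rep_act h x)
}.

Definition rep_carrier (k : comPzRingType) (G : groupType) (V : rep k G) :
  Type := V.

Section RepModule.
Context {k : comPzRingType} {G : groupType} (V : rep k G).
Local Notation kG := (group_ring k G).
Local Notation T := (rep_carrier V).

HB.instance Definition _ := GRing.Zmodule.copy T V.

Definition rep_scale (a : kG) (x : T) : T :=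
  malg_lift (fun g u => u *: rep_act g (x : V)) a.

Let rep_actD g : {morph @rep_act k G V g : x y / x + y}.
Proof. by move=> x y; have := rep_linear g 1 x y; rewrite !scale1r. Qed.

Let rep_actZ g c (x : V) : rep_act g (c *: x) = c *: rep_act g x.
Proof.
by have := rep_linear g c x 0; rewrite !addr0 (morphD0 (rep_actD g)) addr0.
Qed.

Lemma rep_scaleDl x : {morph rep_scale^~ x : a b / a + b}.
Proof. by apply: malg_liftD => g u v; rewrite scalerDl. Qed.

Lemma rep_scaleU g u x : rep_scale << u *g g >> x = u *: rep_act g (x : V).
Proof. by rewrite /rep_scale malg_liftU // => h; rewrite scale0r. Qed.

Let scale0l x : rep_scale 0 x = 0. Proof. exact: (morphD0 (rep_scaleDl x)). Qed.

Lemma rep_scaleDr : right_distributive rep_scale +%R.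
Proof.
move=> a x y; elim/(@gr_ind k G): a => [|a b IHa IHb|g u].
- by rewrite !scale0l addr0.
- by rewrite !rep_scaleDl IHa IHb addrACA.
- by rewrite !rep_scaleU rep_actD scalerDr.
Qed.

Let scale0r a : rep_scale a 0 = 0. Proof. exact: (morphD0 (rep_scaleDr a)). Qed.

Lemma rep_scaleA a b x : rep_scale a (rep_scale b x) = rep_scale (a * b) x.
Proof.
elim/(@gr_ind k G): a => [|a a' IHa IHb|g u].
- by rewrite mul0r !scale0l.
- by rewrite mulrDl !rep_scaleDl IHa IHb.
elim/(@gr_ind k G): b => [|b b' IHa IHb|h v].
- by rewrite mulr0 !scale0l scale0r.
- by rewrite mulrDr !rep_scaleDl rep_scaleDr IHa IHb.
by rewrite [_ * _]gr_mulU !rep_scaleU rep_actM rep_actZ scalerA.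
Qed.

Lemma rep_scale1 : left_id 1 rep_scale.
Proof. by move=> x; rewrite [LHS]rep_scaleU scale1r rep_act1. Qed.

HB.instance Definition _ := GRing.Zmodule_isLmodule.Build kG T
  rep_scaleA rep_scale1 rep_scaleDr rep_scaleDl.

Definition rep_module : lmodType kG := T.

End RepModule.

Definition res_carrier (k : comPzRingType) (G : groupType)
  (M : lmodType (group_ring k G)) : Type := M.

Section Restriction.
Context {k : comPzRingType} {G : groupType} (M : lmodType (group_ring k G)).
Local Notation kG := (group_ring k G).
Local Notation T := (res_carrier M).

HB.instance Definition _ := GRing.Zmodule.copy T M.

Definition res_scale (c : k) (x : T) : T := (gr_scalar c : kG) *: (x : M).

Lemma res_scaleA c d x : res_scale c (res_scale d x) = res_scale (c * d) x.
Proof. by rewrite /res_scale scalerA [_ * _]gr_mulU mulg1. Qed.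

Lemma res_scale1 : left_id 1 res_scale.
Proof. by move=> x; rewrite /res_scale [gr_scalar 1](_ : _ = 1) ?scale1r. Qed.

Lemma res_scaleDr : right_distributive res_scale +%R.
Proof. by move=> c x y; apply: scalerDr. Qed.

Lemma res_scaleDl x : {morph res_scale^~ x : c d / c + d}.
Proof. by move=> c d; rewrite /res_scale /gr_scalar monalgUD scalerDl. Qed.

HB.instance Definition _ := GRing.Zmodule_isLmodule.Build k T
  res_scaleA res_scale1 res_scaleDr res_scaleDl.

Definition res_act (g : G) (x : T) : T := (gr_elt g : kG) *: (x : M).

Lemma res_act_linear g : linear (res_act g).
Proof.
move=> c x y; rewrite /res_act scalerDr; congr (_ + _).
transitivity ((gr_elt g * gr_scalar c : kG) *: (x : M)); first by rewrite -scalerA.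
transitivity ((gr_scalar c * gr_elt g : kG) *: (x : M)); last by rewrite -scalerA.
apply: (congr1 (fun a : kG => a *: (x : M))).
by rewrite [LHS]gr_mulU [RHS]gr_mulU mulg1 mul1g mulr1 mul1r.
Qed.

Lemma res_act1 x : res_act 1%g x = x.
Proof. exact: res_scale1. Qed.

Lemma res_actM g h x : res_act (g * h)%g x = res_act g (res_act h x).
Proof. by rewrite /res_act scalerA [_ * _]gr_mulU mul1r. Qed.

Definition module_rep : rep k G := Rep res_act_linear res_act1 res_actM.

End Restriction.

Section Tensor.
Context {k : comPzRingType} (V W : lmodType k).
Local Notation F := (free_module k (V * W)%type).

Inductive tensor_relator : set F :=
| tensor_addl v v' w : tensor_relator
    (free_gen (v + v', w) - free_gen (v, w) - free_gen (v', w))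
| tensor_addr v w w' : tensor_relator
    (free_gen (v, w + w') - free_gen (v, w) - free_gen (v, w'))
| tensor_scalel c v w : tensor_relator
    (free_gen (c *: v, w) - c *: free_gen (v, w))
| tensor_scaler c v w : tensor_relator
    (free_gen (v, c *: w) - c *: free_gen (v, w)).

Definition tensor_space : lmodType k := quot_module tensor_relator.

Definition tensor (v : V) (w : W) : tensor_space := quot_pi (free_gen (v, w)).

End Tensor.

Section DiagonalAction.
Context {k : comPzRingType} {G : groupType} (V W : rep k G).
Local Notation F := (free_module k (V * W)%type).

Definition diag_free (g : G) : {linear F -> F} :=
  free_lift (fun p : V * W => free_gen (rep_act g p.1, rep_act g p.2)).

Definition diag_act (g : G) (t : tensor_space V W) : tensor_space V W :=
  quot_pi (diag_free g (quot_repr t)).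

Lemma diag_free_gen g v w :
  diag_free g (free_gen (v, w)) = free_gen (rep_act g v, rep_act g w).
Proof. by rewrite /diag_free /= free_lift_gen. Qed.

Let rep_actD (U : rep k G) g : {morph @rep_act k G U g : x y / x + y}.
Proof. by move=> x y; have := rep_linear g 1 x y; rewrite !scale1r. Qed.

Let rep_actZ (U : rep k G) g c (x : U) : rep_act g (c *: x) = c *: rep_act g x.
Proof.
by have := rep_linear g c x 0; rewrite !addr0 (morphD0 (@rep_actD U g)) addr0.
Qed.

Lemma diag_free_span g x : span (@tensor_relator k V W) x ->
  span (@tensor_relator k V W) (diag_free g x).
Proof.
elim=> [_ [v v' w|v w w'|c v w|c v w]||c y z _ IHy _ IHz]; last 2 first.
- by rewrite linear0; apply: span_zero.
- by rewrite linearP; apply: span_lin.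
- by rewrite !linearB !diag_free_gen rep_actD; apply/span_gen/tensor_addl.
- by rewrite !linearB !diag_free_gen rep_actD; apply/span_gen/tensor_addr.
- by rewrite linearB linearZ !diag_free_gen rep_actZ; apply/span_gen/tensor_scalel.
- by rewrite linearB linearZ !diag_free_gen rep_actZ; apply/span_gen/tensor_scaler.
Qed.

Lemma diag_act_pi g x : diag_act g (quot_pi x) = quot_pi (diag_free g x).
Proof.
apply/quot_eqP; rewrite -linearB; apply/asboolP/diag_free_span/asboolP.
by apply/quot_eqP; rewrite quot_reprK.
Qed.

Lemma diag_act_tensor g v w :
  diag_act g (tensor v w) = tensor (rep_act g v) (rep_act g w).
Proof. by rewrite /tensor diag_act_pi diag_free_gen. Qed.

Lemma diag_act_linear g : linear (diag_act g).
Proof.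
move=> c s t; rewrite -[s]quot_reprK -[t]quot_reprK -linearP !diag_act_pi.
by rewrite !linearP.
Qed.

Lemma diag_act1 t : diag_act 1%g t = t.
Proof.
rewrite -[t]quot_reprK diag_act_pi; congr quot_pi.
apply: (@free_linear_ext _ _ _ (diag_free 1%g) idfun) => -[v w].
by rewrite diag_free_gen !rep_act1.
Qed.

Lemma diag_actM g h t : diag_act (g * h)%g t = diag_act g (diag_act h t).
Proof.
rewrite -[t]quot_reprK !diag_act_pi; congr quot_pi.
apply: (@free_linear_ext _ _ _ (diag_free _) (diag_free g \o diag_free h)).
by move=> [v w]; rewrite /comp /= !diag_free_gen !rep_actM.
Qed.

Definition tensor_rep : rep k G := Rep diag_act_linear diag_act1 diag_actM.

End DiagonalAction.

Definition tensor_module (k : comPzRingType) (G : groupType)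
    (M N : lmodType (group_ring k G)) : lmodType (group_ring k G) :=
  rep_module (tensor_rep (module_rep M) (module_rep N)).

Definition finval_fun (G : groupType) (k : comPzRingType) : Type :=
  {fimfun G >-> k}.

Section FinVal.
Context {k : comPzRingType} {G : groupType}.
Local Notation B := (finval_fun G k).

HB.instance Definition _ := GRing.Zmodule.copy B {fimfun G >-> k}.

Definition finval_scale (c : k) (f : B) : B :=
  [fimfun of (fun u => c * u) \o (f : {fimfun G >-> k})].

Lemma finval_scaleA c d f :
  finval_scale c (finval_scale d f) = finval_scale (c * d) f.
Proof. by apply/fimfuneqP => x /=; rewrite mulrA. Qed.

Lemma finval_scale1 : left_id 1 finval_scale.
Proof. by move=> f; apply/fimfuneqP => x /=; rewrite mul1r. Qed.

Lemma finval_scaleDr : right_distributive finval_scale +%R.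
Proof. by move=> c f g; apply/fimfuneqP => x /=; rewrite mulrDr. Qed.

Lemma finval_scaleDl f : {morph finval_scale^~ f : c d / c + d}.
Proof. by move=> c d; apply/fimfuneqP => x /=; rewrite mulrDl. Qed.

HB.instance Definition _ := GRing.Zmodule_isLmodule.Build k B
  finval_scaleA finval_scale1 finval_scaleDr finval_scaleDl.

Lemma finval_act_subproof (g : G) (f : {fimfun G >-> k}) :
  (fun x => f (g^-1 * x)%g) \in fimfun.
Proof.
apply: mem_set; apply: (sub_finite_set _ (fimfunP f)) => _ [x _ <-].
by exists (g^-1 * x)%g.
Qed.

Definition finval_act (g : G) (f : B) : B :=
  fimfun_Sub (finval_act_subproof g f).

Lemma finval_act_linear g : linear (finval_act g).
Proof. by move=> c f f'; apply/fimfuneqP. Qed.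

Lemma finval_act1 f : finval_act 1%g f = f.
Proof. by apply/fimfuneqP => x /=; rewrite invg1 mul1g. Qed.

Lemma finval_actM g h f :
  finval_act (g * h)%g f = finval_act g (finval_act h f).
Proof. by apply/fimfuneqP => x /=; rewrite invgM mulgA. Qed.

Definition finval_rep : rep k G :=
  Rep finval_act_linear finval_act1 finval_actM.

End FinVal.

Definition B_module (G : groupType) (k : comPzRingType) :
  lmodType (group_ring k G) := rep_module (@finval_rep k G).

Definition cofibrant (k : comPzRingType) (G : groupType) :
    @module_class (group_ring k G) :=
  fun M => projective_module (tensor_module M (B_module G k)).

Arguments cofibrant k G : clear implicits.

(* Main.v *)
Require Import Defs.
From HB Require Import structures.
From mathcomp Require Import all_boot all_algebra.
From mathcomp Require Import boolp classical_sets functions cardinality wochoice.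
From mathcomp Require Import finmap.
From mathcomp.multinomials Require Import monalg.

(* Write [H N = Hom_k(B, N)] with the conjugation action, so that maps
   [M (x) B -> N] correspond to maps [M -> H N].

   [B] is free over [k] (Noebeling's theorem, by Bergman's argument).  Well-order
   the subsets of [G]; the products of finitely many indicator functions that are
   not combinations of lexicographically smaller products form a basis.  Hence
   [H] is exact, [- (x) B] preserves projectives and injections, and a cofibrant
   [C] with a free cover [F -> C] and kernel [K] has [K (x) B] as a direct summand
   of [F (x) B].  So syzygies of cofibrant modules are cofibrant, which gives
   heredity by dimension shifting, and every [H N] lies in the right orthogonal
   of the cofibrant modules.

   If [Ext^1(M, H N) = 0] for all [N], then maps from [M] lift along [H p] for
   every surjection [p], which says that [M (x) B] is projective.

   A projective [P] is a direct summand of [H P], because evaluation at the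
   constant function [1] is a surjection [H P -> P]; hence [P] is right
   orthogonal.  If [M] is cofibrant and right orthogonal, then the cokernel of
   [x |-> x (x) 1 : M -> M (x) B] is again cofibrant, thanks to the
   multiplication of [B], so this map splits and [M] is projective. *)

Set Implicit Arguments.
Unset Strict Implicit.
Unset Printing Implicit Defensive.

Import GRing.Theory Defs.
Local Open Scope classical_set_scope.
Local Open Scope ring_scope.

(** * Monomials in a well-ordered family of indicator functions *)

Lemma strict_well_order (I : eqType) : exists lt : rel I,
  [/\ irreflexive lt, transitive lt,
      forall i j, [\/ lt i j, i = j | lt j i] & well_founded lt].
Proof.
have [R woR] := well_ordering_principle I.
have woRT : wo_chain R I by move=> A _; apply: woR.
have Rxx : reflexive R by move=> x; apply: (wo_chain_reflexive woRT).
have Ranti : antisymmetric R by move=> x y; apply: (wo_chain_antisymmetric woRT).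
have Rtot : total R by move=> x y; apply: (wo_chainW woRT).
have Rmin (A : {pred I}) : wochoice.nonempty A ->
    exists2 z, z \in A & forall y, y \in A -> R z y.
  by move=> /woR[z [[Az zmin] _]]; exists z.
(* Look at the least of [x], [y] and [z]; when it is not [x], antisymmetry identifies two of
   them. *)
have Rtr : transitive R.
  move=> y x z xy yz; have [] := Rmin [pred t | t \in [:: x; y; z]].
    by exists x; rewrite !inE eqxx.
  move=> t; rewrite !inE => /or3P[]/eqP-> tmin.
  - by apply: tmin; rewrite !inE eqxx !orbT.
  - suff <- : y = x by [].
    by apply: Ranti; rewrite xy andbT tmin // !inE eqxx ?orbT.
  - suff <- : y = z by [].
    by apply: Ranti; rewrite yz tmin // !inE eqxx ?orbT.
exists (fun i j => R i j && (i != j)); split.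
- by move=> i; rewrite eqxx andbF.
- move=> y x z /andP[xy nxy] /andP[yz nyz]; rewrite (Rtr _ _ _ xy yz) /=.
  by apply: contra nxy => /eqP xz; apply/eqP/Ranti; rewrite xy xz yz.
- move=> i j; have [->|nij] := eqVneq i j; first by constructor 2.
  by rewrite !andbT; case/orP: (Rtot i j) => ->;
    [constructor 1|constructor 3].
(* A least non-accessible element would have only accessible strict predecessors. *)
move=> i; apply: contrapT => nAi.
pose A : {pred I} := [pred j | `[< ~ Acc (fun i j => R i j && (i != j)) j >]].
have [|z /asboolP nAz zmin] := Rmin A; first by exists i; apply/asboolP.
apply: nAz; constructor => y /andP[yz nyz]; apply: contrapT => nAy.
case/eqP: nyz; apply: Ranti; rewrite yz zmin //; exact/asboolP.
Qed.

Section SpanClosure.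
Context {R : pzRingType} {M : lmodType R}.
Implicit Types (c : R) (x y : M) (A : set M).

Lemma spanZ A c x :
  span A x -> span A (c *: x).
Proof. by move=> Ax; rewrite -[_ *: _]addr0; apply: span_lin Ax (span_zero _). Qed.

Lemma spanD A x y :
  span A x -> span A y -> span A (x + y).
Proof. by move=> Ax Ay; rewrite -[x]scale1r; apply: span_lin. Qed.

Lemma spanS A A' :
  (forall x, A x -> span A' x) -> forall x, span A x -> span A' x.
Proof.
move=> AA' x; elim=> [y /AA'//||c y z _ Ay _ Az]; first exact: span_zero.
exact: span_lin.
Qed.

End SpanClosure.

Section Monomials.
Context {X : Type} {k : comPzRingType} {I : choiceType}.
Context (lt : rel I) (e : I -> X -> bool).
Context (lt_irr : irreflexive lt) (lt_trans : transitive lt).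
Context (lt_total : forall i j, [\/ lt i j, i = j | lt j i]).
Context (lt_wf : well_founded lt).
Implicit Types (c : k) (i j : I) (s t p : seq I) (f g r v : X -> k^o) (D : {pred I}).

Definition dependent (l : seq I) f :=
  forall x y, (forall i, i \in l -> e i x = e i y) -> f x = f y.

(** This is the [k]-algebra generated by the [e i] with [i] in [D], described by dependence on
    finitely many of them so that closure under pointwise operations is immediate. *)
Definition local D f := exists2 l, {subset l <= D} & dependent l f.

Definition below i : {pred I} := lt^~ i.

Definition monomial s : X -> k^o := fun x => (all (e^~ x) s)%:R.

Definition descending s := pairwise (fun i j => lt j i) s.

Let pt0 x : (0 : X -> k^o) x = 0. Proof. by []. Qed.
Let ptD f g x : (f + g) x = f x + g x. Proof. by []. Qed.
Let ptN f x : (- f) x = - f x. Proof. by []. Qed.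
Let ptZ c f x : (c *: f) x = c * f x. Proof. by []. Qed.
Let ptM f g x : (f \* g) x = f x * g x. Proof. by []. Qed.
Let ptE := (pt0, ptD, ptN, ptZ, ptM).

(** An arbitrary [op] is allowed because truncation to the support of a function is needed besides
    the algebra operations. *)
Lemma local_op2 D (op : k^o -> k^o -> k^o) f g :
  local D f -> local D g -> local D (fun x => op (f x) (g x)).
Proof.
move=> [l lD lf] [m mD mg]; exists (l ++ m).
  by move=> i; rewrite mem_cat => /orP[/lD|/mD].
by move=> x y xy; congr op; [apply: lf|apply: mg] => i im; apply: xy;
  rewrite mem_cat im ?orbT.
Qed.

Lemma local_cst D (c : k) : local D (fun=> c : k^o).
Proof. by exists [::]. Qed.

Lemma localS D D' f : {subset D <= D'} -> local D f -> local D' f.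
Proof. by move=> DD' [l lD lf]; exists l => // i /lD/DD'. Qed.

Lemma local_monomial D s : {subset s <= D} -> local D (monomial s).
Proof.
move=> sD; exists s => // x y xy; rewrite /monomial; congr (nat_of_bool _)%:R.
exact: eq_in_all.
Qed.

Lemma localP D c f g : local D f -> local D g -> local D (c *: f + g).
Proof. exact: (@local_op2 D (fun a b => c * a + b)). Qed.

Lemma localM D f g : local D f -> local D g -> local D (f \* g).
Proof. exact: (@local_op2 D *%R). Qed.

Lemma monomial_cons i s : monomial (i :: s) = monomial [:: i] \* monomial s.
Proof.
by apply/funext => x; rewrite /monomial /= andbT; case: (e i x);
  rewrite ?mul1r ?mul0r.
Qed.

Lemma monomial_cat p s : monomial (p ++ s) = monomial p \* monomial s.
Proof.
by apply/funext => x; rewrite /monomial /= all_cat; case: (all _ p);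
  rewrite ?mul1r ?mul0r.
Qed.

Lemma monomial1 i x : monomial [:: i] x = (e i x)%:R.
Proof. by rewrite /monomial /= andbT. Qed.

(* The span of the monomials that are lexicographically smaller than [s], when
   [s] is descending. *)
Fixpoint lower s : (X -> k^o) -> Prop :=
  if s is i :: t then fun f => exists r v,
    [/\ local (below i) r, lower t v & f = r + monomial [:: i] \* v]
  else fun f => f = 0.

Lemma lower_lin s c f g : lower s f -> lower s g -> lower s (c *: f + g).
Proof.
elim: s f g => [|i s IH] f g /=; first by move=> -> ->; rewrite scaler0 addr0.
move=> [r [v [lr lv ->]]] [r' [v' [lr' lv' ->]]].
exists (c *: r + r'), (c *: v + v'); split; [exact: localP|exact: IH|].
apply/funext => x; rewrite !ptE !mulrDr addrACA.
by congr (_ + (_ + _)); exact: mulrCA.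
Qed.

Lemma lower0 s : lower s 0.
Proof.
elim: s => [|i s IH] //=; exists 0, 0; split => //; first exact: local_cst.
by apply/funext => x; rewrite !ptE mulr0 addr0.
Qed.

Lemma lower_local i s f : descending (i :: s) -> lower s f -> local (below i) f.
Proof.
elim: s f => [|j s IH] f /=; first by move=> _ ->; apply: local_cst.
move=> /andP[/andP[ji si] /andP[sj ds]] [r [v [lr lv ->]]].
have mj : local (below i) (monomial [:: j]).
  by apply: local_monomial => l; rewrite inE => /eqP->.
have lrv : local (below i) (monomial [:: j] \* v).
  by apply: localM => //; apply: IH => //=; apply/andP.
rewrite -[r]scale1r; apply: localP => //; apply: localS lr => l lj.
exact: lt_trans lj ji.
Qed.

Definition solid D (J : (X -> k^o) -> Prop) := forall f g,
  J f -> local D g -> (forall x, f x = 0 -> g x = 0) -> J g.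

(* [s = i :: t] is reduced to [t] by replacing [J] with the ideal of the functions
   [w], local below [i], such that [e i * w] is congruent modulo [J] to a function
   local below [i]. *)
Lemma lower_pure_solid D J s c :
  solid D J -> c <> 0 -> descending s -> {subset s <= D} ->
  {in s, forall i, {subset below i <= D}} ->
  (exists2 v, lower s v & J (c *: monomial s - v)) ->
  exists2 v, lower s v & J (monomial s - v).
Proof.
move=> + c0; elim: s D J => [|i s IH] D J solJ /=.
  move=> _ _ _ [v -> Jc]; exists 0; rewrite ?subr0 // in Jc *.
  (* [Jc] now concerns the constant [c], which vanishes nowhere, so solidity puts the constant 1 in
     [J]. *)
  apply: (solJ _ _ Jc); first exact: local_monomial.
  by move=> x; rewrite ptE /monomial /= mulr1 => /c0.
move=> /andP[si ds] sD bD [_ [r [v [lr lv ->]]] Jc].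
have iD : i \in D by apply: sD; rewrite mem_head.
have biD : {subset below i <= D} by apply: bD; rewrite mem_head.
have dis : descending (i :: s) by rewrite /= si.
have sbi : {subset s <= below i} by move=> j js; apply: (allP si).
pose J' w := local (below i) w /\
  exists2 r, local (below i) r & J (monomial [:: i] \* w - r).
have solJ' : solid (below i) J'.
  move=> f g [lf [q lq Jq]] lg fg; split=> //.
  (* Where [e i * f = q], this witness equals [e i * g]: if [e i] is 0 there, then [q] vanishes; if
     it is 1, then [q] equals [f], whose zeros are zeros of [g]. *)
  exists (fun x => g x * (q x != 0)%:R).
    exact: (@local_op2 _ (fun a b => a * (b != 0)%:R)).
  apply: (solJ _ _ Jq).
    have mi : local D (monomial [:: i]).
      by apply: local_monomial => l; rewrite inE => /eqP->.
    rewrite addrC -scaleN1r; apply: localP; last first.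
      exact/localM/(localS biD).
    apply: localS biD _.
    exact: (@local_op2 _ (fun a b => a * (b != 0)%:R)).
  move=> x; rewrite !ptE monomial1 => /eqP; rewrite subr_eq0 => /eqP <-.
  case: (e i x); rewrite ?mul1r ?mul0r ?eqxx ?mulr0 ?subr0 //.
  by case: eqVneq => [/fg ->|_]; rewrite ?mulr1 ?mul0r subrr.
have [] := IH _ J' solJ' ds sbi.
- by move=> j js l lj; apply: lt_trans lj (sbi _ js).
(* Factoring out [e i] turns [Jc] into [e i * (c *: monomial s - v) - r] in [J], which puts
   [c *: monomial s - v] in [J']. *)
- exists v => //; split.
    rewrite addrC -scaleN1r; apply: localP; first exact: lower_local lv.
    rewrite -[_ *: _]addr0; apply: localP; first exact: local_monomial.
    exact: local_cst.
  exists r => //; congr (J _): Jc; apply/funext => x; rewrite !ptE.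
  rewrite [monomial (_ :: s)]monomial_cons /= opprD addrA addrAC mulrBr.
  congr (_ - _ - _).
  exact: mulrCA.
- move=> w lw [_ [q lq Jq]]; exists (q + monomial [:: i] \* w).
    by exists q, w; split.
  congr (J _): Jq; apply/funext => x; rewrite !ptE.
  by rewrite [monomial (_ :: s)]monomial_cons /= mulrBr opprD addrA addrAC.
Qed.

(** The zero ideal is solid, so the general statement cancels [c]. *)
Lemma lower_pure s c : c <> 0 -> descending s ->
  lower s (c *: monomial s) -> lower s (monomial s).
Proof.
move=> c0 ds ls; have solJ : solid predT (fun f => f = 0).
  by move=> f g -> _ fg; apply/funext => x; apply: fg.
have [//|//||v lv /subr0_eq -> //] := lower_pure_solid solJ c0 ds.
by exists (c *: monomial s); rewrite ?subrr.
Qed.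

Fixpoint lexlt s t := match s, t with
  | _, [::] => false
  | [::], _ :: _ => true
  | i :: s', j :: t' => lt i j || (i == j) && lexlt s' t'
  end.

Lemma lexlt_trans : transitive lexlt.
Proof.
elim=> [|j t IH] [|i s] [|l u] //= /orP[ij|/andP[/eqP-> st]].
- by case/orP=> [/(lt_trans ij)->//|/andP[/eqP<- _]]; rewrite ij.
- by case/orP=> [->//|/andP[/eqP-> tu]]; rewrite eqxx (IH _ _ st tu) orbT.
Qed.

Lemma lexlt_total s t : [\/ lexlt s t, s = t | lexlt t s].
Proof.
elim: s t => [|i s IH] [|j t] /=; try by [constructor 1|constructor 2|constructor 3].
have [->|->|->] := lt_total i j; [by constructor 1| |by constructor 3].
by rewrite lt_irr eqxx /=; have [|->|] := IH t;
  [constructor 1|constructor 2|constructor 3].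
Qed.

Lemma lexlt_max (L : seq (seq I)) : L != [::] ->
  exists2 s, s \in L & forall t, t \in L -> t != s -> lexlt t s.
Proof.
elim: L => [//|s L IH] _; have [->|/IH[t tL tmax]] := eqVneq L [::].
  by exists s; rewrite ?inE // => t; rewrite inE => ->.
have [st|st|ts] := lexlt_total s t.
- exists t; rewrite ?inE ?tL ?orbT // => u; rewrite inE => /orP[/eqP->|] //.
  exact: tmax.
- exists t; rewrite ?inE ?tL ?orbT // => u; rewrite inE st.
  by move=> /orP[->//|]; apply: tmax.
- exists s; rewrite ?inE ?eqxx // => u; rewrite inE => /orP[->//|uL _].
  by have [->//|/(tmax _ uL)ut] := eqVneq u t; apply: lexlt_trans ut ts.
Qed.

(** At the first difference, what is left of [monomial s] is either 1 or a descending product that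
    starts below the index of [t] there; it serves as the local term [r]. *)
Lemma lower_lexlt s t : descending s -> lexlt s t -> lower t (monomial s).
Proof.
elim: t s => [|j t IH] [|i s] //=.
  move=> _ _; exists (monomial [::]), 0; split; [exact: local_monomial|exact: lower0|].
  by apply/funext => x; rewrite !ptE mulr0 addr0.
move=> /andP[si ds] /orP[ij|/andP[/eqP<- st]].
  exists (monomial (i :: s)), 0; split; [|exact: lower0|].
    apply: local_monomial => l; rewrite inE => /orP[/eqP->//|/(allP si) li].
    exact: lt_trans li ij.
  by apply/funext => x; rewrite !ptE mulr0 addr0.
exists 0, (monomial s); split; [exact: local_cst|exact: IH|].
by rewrite monomial_cons add0r.
Qed.

Definition good s := descending s /\ ~ lower s (monomial s).

(** In a nontrivial relation the lexicographically largest term lies in its own [lower];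
    [lower_pure] removes the coefficient and contradicts goodness. *)
Lemma good_independent (L : seq (seq I)) (c : seq I -> k) :
  uniq L -> {in L, forall s, good s} -> {in L, forall s, c s != 0} ->
  \sum_(s <- L) c s *: monomial s = 0 -> L = [::].
Proof.
move=> uL gL cL sum0; apply/eqP/negPn/negP => /lexlt_max[s sL smax].
have [ds] := gL _ sL; apply; apply: (@lower_pure s (c s)) => //.
  by apply/eqP/cL.
move: sum0; rewrite (bigD1_seq s) //= => /eqP; rewrite addr_eq0 => /eqP->.
rewrite -sumrN big_seq_cond; elim/big_ind: _ => [|f g lf lg|t /andP[tL ts]].
- exact: lower0.
- by rewrite -[f]scale1r; apply: lower_lin.
- rewrite -scaleNr -[_ *: _]addr0; apply: lower_lin; last exact: lower0.
  by apply: lower_lexlt; [have [] := gL _ tL|apply: smax].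
Qed.

Notation monomial_span P := (span [set monomial s | s in P]).

Lemma dependent_span l f : dependent l f ->
  monomial_span [set s | subseq s l] f.
Proof.
move=> lf.
(* [F] takes the value 0 on bit lists that no point realizes. *)
have [F Ff] : exists F : seq bool -> k^o, forall x, f x = F [seq e i x | i <- l].
  exists (fun b => if pselect (exists x, [seq e i x | i <- l] = b) is left h
                   then f (projT1 (cid h)) else 0).
  move=> x; case: pselect => [h|[]]; last by exists x.
  case: (cid h) => y /= yx; apply: lf => i il; symmetry.
  by have /eq_in_map := yx; apply.
rewrite (_ : f = fun x => F [seq e i x | i <- l]); last exact/funext.
elim: l {f lf} F {Ff} => [|i l IH] F /=.
  rewrite (_ : (fun=> _) = F [::] *: monomial [::]).
    by apply/spanZ/span_gen; exists [::].
  by apply/funext => x; rewrite ptE /monomial mulr1.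
set F0 := fun x => F (false :: [seq e j x | j <- l]).
set F1 := fun x => F (true :: [seq e j x | j <- l]).
(* Interpolation in the first bit: [F0] where [e i] is false, [F1] where it is true. *)
rewrite (_ : (fun x => _) = F0 + monomial [:: i] \* ((-1) *: F0 + F1)); last first.
  apply/funext => x; rewrite !ptE monomial1 mulN1r /F0 /F1.
  by case: (e i x); rewrite ?mul1r ?mul0r ?addr0 // addrA addrN add0r.
have S0 : monomial_span [set s | subseq s l] F0 by apply: IH (fun b => F (_ :: b)).
have S1 : monomial_span [set s | subseq s l] F1 by apply: IH (fun b => F (_ :: b)).
apply: spanD.
  apply: spanS S0 => _ [s sl <-]; apply: span_gen; exists s => //.
  exact: subseq_trans sl (subseq_cons _ _).
move: (span_lin (-1) S0 S1); elim=> [_ [s sl <-]||c g h _ IHg _ IHh].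
- rewrite -monomial_cons; apply: span_gen; exists (i :: s) => //.
  by rewrite /= eqxx.
- rewrite (_ : _ \* _ = 0); first exact: span_zero.
  by apply/funext => x; rewrite !ptE mulr0.
- rewrite (_ : _ \* _ = c *: (monomial [:: i] \* g) + monomial [:: i] \* h).
    exact: span_lin.
  apply/funext => x; rewrite !ptE mulrDr; congr (_ + _); exact: mulrCA.
Qed.

(** Sorting the indices without repetition gives a descending list, and its sublists stay
    descending. *)
Lemma local_span D f : local D f ->
  monomial_span [set s | descending s /\ {subset s <= D}] f.
Proof.
move=> [l lD lf]; pose le : rel I := fun i j => (i == j) || lt j i.
have le_tr : transitive le.
  move=> j i l'; rewrite /le => /orP[/eqP->//|ij] /orP[/eqP<-|jl].
    by rewrite ij orbT.
  by rewrite (lt_trans jl ij) orbT.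
have le_tot : total le.
  by move=> i j; rewrite /le; have [->|->|->] := lt_total i j; rewrite ?eqxx ?orbT.
pose m := sort le (undup l).
have lem : pairwise le m by rewrite -sorted_pairwise // sort_sorted.
have dm : descending m.
  have um : uniq m by rewrite sort_uniq undup_uniq.
  rewrite /descending; elim: m lem um => //= i m IH /andP[im lem] /andP[nim um].
  rewrite IH // andbT; apply/allP => j jm.
  have /orP[/eqP ij|//] := allP im _ jm; by rewrite ij jm in nim.
have mf : dependent m f.
  by move=> x y xy; apply: lf => i il; apply: xy; rewrite mem_sort mem_undup.
apply: spanS (dependent_span mf) => _ [s sm <-]; apply: span_gen; exists s => //.
split; first exact: subseq_pairwise sm dm.
by move=> i /(mem_subseq sm); rewrite mem_sort mem_undup => /lD.
Qed.

Notation good_span := (monomial_span good).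

(** [lower] recurses from the front; this opens it at the back, where prefixes grow. *)
Lemma lower_rcons p i f : lower (rcons p i) f -> exists v r,
  [/\ lower p v, local (below i) r & f = v + monomial p \* r].
Proof.
elim: p f => [|j p IH] f /=.
  move=> [r [_ [lr -> ->]]]; exists 0, r; split => //; apply/funext => x.
  by rewrite !ptE mulr0 addr0 add0r /monomial mul1r.
move=> [r [_ [lr /IH[v [q [lv lq ->]]] ->]]].
exists (r + monomial [:: j] \* v), q; split => //; first by exists r, v.
apply/funext => x; rewrite !ptE [monomial (_ :: p)]monomial_cons mulrDr addrA.
by rewrite ptM mulrA.
Qed.

(* Well-founded induction on the first index that follows the prefix [p]: passing
   from [p] to [rcons p i] enlarges [lower p] by the multiples of [monomial p] with
   factors of index below [i], which are covered by the induction hypothesis. *)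
Lemma lower_good_span p s : (forall f, lower p f -> good_span f) ->
  descending (p ++ s) -> good_span (monomial (p ++ s)).
Proof.
have nilP q : (forall f, lower q f -> good_span f) -> descending q ->
    good_span (monomial q).
  move=> Vq dq; have [lq|nlq] := pselect (lower q (monomial q)); first exact: Vq.
  by apply: span_gen; exists q.
suff step i : forall q t, (forall f, lower q f -> good_span f) ->
    descending (q ++ i :: t) -> good_span (monomial (q ++ i :: t)).
  case: s => [|i s]; last exact: step.
  by rewrite cats0; apply: nilP.
elim/(well_founded_ind lt_wf): i => i IH q t Vq dqit.
have dqi : descending (rcons q i).
  move: dqit; rewrite -cat_rcons /descending pairwise_cat.
  by case/and3P.
have Vqi f : lower (rcons q i) f -> good_span f.
  move=> /lower_rcons[v [r [/Vq Sv lr ->]]]; apply: spanD => //.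
  have : good_span (monomial q \* (0 : X -> k^o)).
    rewrite (_ : _ \* _ = 0); first exact: span_zero.
    by apply/funext => x; rewrite !ptE mulr0.
  elim: (local_span lr) => [_ [s' [ds' s'i] <-] _||c g h _ IHg _ IHh S0] //.
    have dqs : descending (q ++ s').
      move: dqi; rewrite -cats1 /descending !pairwise_cat => /and3P[qi dq _].
      rewrite dq [pairwise _ s']ds' !andbT; apply/allrelP => a b aq bs.
      move: qi => /allrelP/(_ a i aq); rewrite mem_head => /(_ isT).
      exact/lt_trans/s'i.
    rewrite -monomial_cat; case: s' s'i {ds'} dqs => [|j s'] s'i dqs.
      by move: dqs; rewrite cats0; apply: nilP.
    by apply: IH => //; apply: s'i; rewrite mem_head.
  rewrite (_ : _ \* _ = c *: (monomial q \* g) + monomial q \* h).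
    by apply: span_lin; [apply: IHg|apply: IHh].
  apply/funext => x; rewrite !ptE mulrDr; congr (_ + _); exact: mulrCA.
(* Since [Vqi] makes [rcons q i] an admissible prefix, the rest of the list, which starts with [j]
   below [i], falls to the induction hypothesis. *)
case: t dqit => [|j t] dqit; first by rewrite cats1; apply: nilP.
rewrite -cat_rcons; apply: IH => //; last by rewrite cat_rcons.
by move: dqit; rewrite /descending pairwise_cat => /and3P[_ _ /andP[/andP[]]].
Qed.

Lemma local_good_span D f : local D f -> good_span f.
Proof.
move=> /local_span; apply: spanS => _ [s [ds _] <-].
apply: (@lower_good_span [::]) => // _ ->; exact: span_zero.
Qed.

End Monomials.

(** * Projectivity of the finite-valued functions over [k] *)

Lemma basis_projective (R : pzRingType) (L : lmodType R) (T : choiceType)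
    (u : T -> L) :
  (forall x, span (range u) x) ->
  (forall a : free_module R T, free_lift u a = 0 -> a = 0) ->
  projective_module L.
Proof.
move=> u_span u_free M N p f p_surj.
have [g0 g0P] := @free_projective R T _ _ p (f \o free_lift u) p_surj.
have u_surj x : exists a, free_lift u a = x.
  elim: (u_span x) => [_ [t _ <-]||c y z _ [a <-] _ [b <-]].
  - by exists (free_gen t); rewrite free_lift_gen.
  - by exists 0; rewrite linear0.
  - by exists (c *: a + b); rewrite linearP.
have [s sK] := choice u_surj.
(* Injectivity of [free_lift u] makes the chosen section linear. *)
have s_lin : linear s.
  move=> c x y; apply/subr0_eq/u_free; rewrite linearB /= free_lift_linear.
  by rewrite !sK subrr.
pose sl : {linear L -> free_module R T} :=
  HB.pack s (GRing.isLinear.Build R L (free_module R T) *:%R s s_lin).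
by exists (g0 \o sl) => x; rewrite /= g0P /= sK.
Qed.

Lemma finval_projective (k : comPzRingType) (G : groupType) :
  projective_module (rep_space (@finval_rep k G)).
Proof.
have [lt [lt_irr lt_tr lt_tot lt_wf]] := strict_well_order (set G).
pose e (A : set G) (x : G) := `[< A x >].
pose mon : seq (set G) -> G -> k^o := monomial e.
pose T := {s : seq (set G) | `[< good lt e s (k := k) >]}.
have mon_fin s : (mon s : G -> k) \in fimfun.
  apply: mem_set; apply: (@sub_finite_set _ _ [set 0; 1]); last exact: finite_set2.
  by move=> _ [x _ <-]; rewrite /mon /monomial; case: all; [right|left].
pose u (t : T) : @finval_rep k G := fimfun_Sub (mon_fin (val t)).
have finvalP (f g : @finval_rep k G) :
    (f : {fimfun G >-> k}) =1 (g : {fimfun G >-> k}) -> f = g.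
  by move=> fg; apply/fimfuneqP.
apply: (basis_projective (u := u)).
  move=> f; have : local e predT ((f : {fimfun G >-> k}) : G -> k^o).
    have /finite_seqP[vs vsE] := fimfunP (f : {fimfun G >-> k}).
    (* A function with finite range is determined by its finitely many level sets. *)
    exists [seq (f : {fimfun G >-> k}) @^-1` [set v] | v <- vs] => // x y xy.
    have fx : (f : {fimfun G >-> k}) x \in vs.
      have : range (f : {fimfun G >-> k}) ((f : {fimfun G >-> k}) x) by exists x.
      by rewrite vsE.
    have := xy _ (map_f _ fx); rewrite /e /=.
    rewrite (_ : `[< _ >] = true); last exact/asboolP.
    by move=> /esym/asboolP.
  move=> /(local_good_span lt_tr lt_tot lt_wf).
  suff H h : span [set monomial e s | s in good lt e (k := k)] h ->
      exists2 b : @finval_rep k G, span (range u) b &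
        (b : {fimfun G >-> k}) =1 h.
    by move=> /H[b ub /finvalP <-].
  elim=> [_ [s gs <-]||c g1 g2 _ [b1 ub1 b1E] _ [b2 ub2 b2E]].
  - exists (u (Sub s (asboolT gs))) => //.
    by apply: span_gen; exists (Sub s (asboolT gs)).
  - by exists 0; [apply: span_zero|].
  - exists (c *: b1 + b2); first exact: span_lin.
    by move=> x; rewrite -[LHS]/(c * (b1 : {fimfun G >-> k}) x
      + (b2 : {fimfun G >-> k}) x) b1E b2E.
move=> a a0.
have uE : [seq val t | t <- msupp a] = [::].
  (* The coefficients of [a] are extended by 0 to the lists that are not good. *)
  pose c (s : seq (set G)) : k := if insub s is Some t then a@_(t : T) else 0.
  have cE t : c (val t) = a@_t by rewrite /c valK.
  apply: (good_independent lt_irr lt_tr lt_tot (c := c)).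
  - by rewrite map_inj_uniq //; exact: val_inj.
  - by move=> _ /mapP[t _ ->]; apply/asboolP/(valP t).
  - by move=> _ /mapP[t ta ->]; rewrite cE mcoeff_neq0.
  rewrite big_map; apply/funext => x; rewrite fct_sumE.
  pose ev (b : @finval_rep k G) := (b : {fimfun G >-> k}) x.
  have evD : {morph ev : b b' / b + b'} by [].
  transitivity (ev (free_lift u a)); last by rewrite a0.
  rewrite /free_lift /malg_lift (big_morph ev evD (erefl : ev 0 = 0)).
  by apply: eq_bigr => t _; rewrite cE.
apply/malgP => t; rewrite mcoeff0; apply: mcoeff_outdom.
by apply/negP => /(map_f val); rewrite uE.
Qed.

(** * Linear maps and Ext *)

Lemma quot_trivial (V : zmodType) (S : zmodClosed V) :
  (forall x : Quotient.quot S, x = 0) <-> forall v, v \in S.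
Proof.
have pi0 v : \pi_(Quotient.quot S)%qT v = 0 <-> v \in S.
  rewrite -{2}[v]subr0 Quotient.idealrBE -(rwP eqP).
  by rewrite (raddf0 (\pi_(Quotient.quot S)%qT)).
split=> [S0 v|SV x]; first exact/pi0.
by rewrite -[x]reprK; apply/pi0.
Qed.

Section LinearMaps.
Context {R : pzRingType}.
Implicit Types K F C E M N P L : lmodType R.

Lemma linear_map M N (f : M -> N) : linear f -> exists g : {linear M -> N}, g =1 f.
Proof.
move=> f_lin.
by exists (HB.pack_for {linear M -> N} f (GRing.isLinear.Build R M N *:%R f f_lin)).
Qed.

Lemma factor_surj F C N (q : {linear F -> C}) (f : {linear F -> N}) :
  surj q -> (forall x, q x = 0 -> f x = 0) ->
  exists g : {linear C -> N}, forall x, g (q x) = f x.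
Proof.
move=> /choice[s sK] f0.
have fE x y : q x = q y -> f x = f y.
  by move=> qxy; apply/subr0_eq; rewrite -linearB f0 // linearB qxy subrr.
have [|g gE] := @linear_map C N (f \o s).
  by move=> c x y /=; rewrite -linearP; apply: fE; rewrite linearP !sK.
by exists g => x; rewrite gE; apply: fE; rewrite sK.
Qed.

Lemma factor_inj K F N (i : {linear K -> F}) (f : {linear N -> F}) :
  injective i -> (forall x, range i (f x)) ->
  exists g : {linear N -> K}, forall x, i (g x) = f x.
Proof.
move=> i_inj fi; have /choice[g gE] x : exists y, i y = f x.
  by have [y _ <-] := fi x; exists y.
have [|h hE] := @linear_map N K g; last by exists h => x; rewrite hE.
by move=> c x y; apply: i_inj; rewrite linearP !gE linearP.
Qed.

Lemma retract_projective P L (i : {linear L -> P}) (r : {linear P -> L}) :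
  cancel i r -> projective_module P -> projective_module L.
Proof.
move=> irK prP M N p f /(prP _ _ p (f \o r))[g gP].
by exists (g \o i) => x; rewrite /= gP /= irK.
Qed.

Lemma span_range M N (f : {linear M -> N}) y : span (range f) y -> range f y.
Proof.
elim=> [//||c x z _ [x' _ <-] _ [z' _ <-]]; first by exists 0; rewrite ?linear0.
by exists (c *: x' + z'); rewrite ?linearP.
Qed.

Lemma quot_range M N (f : {linear M -> N}) x :
  quot_pi x = 0 :> quot_module (range f) <-> range f x.
Proof.
rewrite -[0](linear0 (@quot_pi R N (range f))) quot_eqP subr0.
split=> [/asboolP/span_range//|fx]; exact/asboolP/span_gen.
Qed.

(** A cocycle kills the next differential, hence factors through the syzygy; it is a coboundary
    exactly when this factor extends to the free module. *)
Lemma Ext_vanishesP n M N : Ext_vanishes n.+1 M N <->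
  forall h : {linear kernel (free_cover (syzygy n M)) -> N},
  exists g : {linear free_module R (syzygy n M) -> N}, forall x, g (val x) = h x.
Proof.
rewrite /Ext_vanishes /Ext /hom_cohomology quot_trivial; split=> [ext0 h|ext c].
  have c_lin : linear (h \o free_cover (syzygy n.+1 M)) by exact: linearP.
  have cP : (h \o free_cover (syzygy n.+1 M) : res_mod (std_resolution M) n.+1 -> N)
      \in @cocycleb R M (std_resolution M) N n.+1.
    apply/asboolP; split=> // x /=.
    by have /eqP-> := kernelP (free_cover (syzygy n.+2 M) x); rewrite linear0.
  have /asboolP[g gP] := ext0 (Cocycle cP).
  exists g => y; have [x <-] := @free_cover_surj R (syzygy n.+1 M) y.
  exact/esym/gP.
have /asboolP[c_lin c0] := cocycleP c.
have [f fE] := linear_map c_lin.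
have [|h hE] := @factor_surj (std_mod M n.+1) (syzygy n.+1 M) N
   (free_cover (syzygy n.+1 M)) f (@free_cover_surj R (syzygy n.+1 M)).
  by move=> x /std_range[y _ <-]; rewrite fE; apply: c0.
have [g gE] := ext h; apply/asboolP; exists g => x.
by rewrite -[LHS]fE -hE; apply/esym/gE.
Qed.

(** Lift [f] from the free cover to a map [a] into [E]. On the kernel, [a] comes from [N]; extend
    that map to the cover and subtract it, so that [a] descends to [M]. *)
Lemma Ext1_lift M N E C (i : {linear N -> E}) (q : {linear E -> C})
    (f : {linear M -> C}) :
  Ext_vanishes 1 M N -> injective i -> surj q ->
  (forall x, q x = 0 <-> range i x) ->
  exists g : {linear M -> E}, forall x, q (g x) = f x.
Proof.
move=> /Ext_vanishesP /= ext i_inj q_surj iq.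
have [a aE] := @free_projective R M _ _ q (f \o free_cover M) q_surj.
have [|h hE] := @factor_inj _ _ _ i
    (a \o (val : kernel (free_cover M) -> free_module R M)) i_inj.
  by move=> x; apply/iq; rewrite /= aE /=; have /eqP-> := kernelP x; rewrite linear0.
have [b bE] := ext h.
have [|g gE] := @factor_surj _ _ _ (free_cover M) (a \- (i \o b)) (@free_cover_surj _ M).
  move=> x /eqP x0; by rewrite /= (bE (Kernel x0)) hE subrr.
exists g => x; have [y <-] := @free_cover_surj _ M x.
have qi z : q (i z) = 0 by apply/iq; exists z.
by rewrite gE /= linearB qi subr0 aE.
Qed.

End LinearMaps.

(** * The adjunction between tensor product and Hom *)

Section LinearFunctions.
Context {k : comPzRingType} (V W : lmodType k).

Definition linear_pred : {pred V -> W} := fun f => `[< linear f >].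

Lemma linear_pred_closed : submod_closed linear_pred.
Proof.
split=> [|a f g /asboolP fl /asboolP gl]; apply/asboolP => c x y.
  by rewrite -[RHS]/(c *: 0 + 0) scaler0 addr0.
rewrite -[LHS]/(a *: f _ + g _) fl gl !scalerDr addrACA !scalerA mulrC.
by rewrite -scalerA -scalerDr.
Qed.

HB.instance Definition _ :=
  GRing.isSubmodClosed.Build k (V -> W) linear_pred linear_pred_closed.

Record hom_space :=
  HomSpace { hom_fun :> V -> W; hom_funP : hom_fun \in linear_pred }.

HB.instance Definition _ := [isSub for hom_fun].
HB.instance Definition _ := [Choice of hom_space by <:].
HB.instance Definition _ := [SubChoice_isSubLmodule of hom_space by <:].

Lemma hom_fun_linear (f : hom_space) : linear f.
Proof. exact/asboolP/hom_funP. Qed.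

Lemma hom_spaceP (f g : hom_space) : f =1 g -> f = g.
Proof. by move=> fg; apply/val_inj/funext. Qed.

End LinearFunctions.

Section TensorLift.
Context {k : comPzRingType} {V W : lmodType k}.

Lemma tensor_lift (U : lmodType k) (b : V -> W -> U) :
  (forall v, linear (b v)) -> (forall w, linear (b^~ w)) ->
  exists u : {linear tensor_space V W -> U}, forall v w, u (tensor v w) = b v w.
Proof.
move=> bl br.
pose f : {linear free_module k (V * W)%type -> U} := free_lift (fun p => b p.1 p.2).
have fE v w : f (free_gen (v, w)) = b v w by rewrite /f /= free_lift_gen.
have [q|x x0|u uE] := @factor_surj _ _ (tensor_space V W) U (@quot_pi _ _ _) f.
- by exists (quot_repr q); apply: quot_reprK.
- have : span (@tensor_relator k V W) x.
    by apply/asboolP; rewrite -[x]subr0; apply/quot_eqP; rewrite x0 linear0.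
  have blD v w w' : b v (w + w') = b v w + b v w'.
    by have := bl v 1 w w'; rewrite !scale1r.
  have brD v v' w : b (v + v') w = b v w + b v' w.
    by have := br w 1 v v'; rewrite !scale1r.
  have bl0 v : b v 0 = 0 by apply: (addrI (b v 0)); rewrite -blD !addr0.
  have br0 w : b 0 w = 0 by apply: (addrI (b 0 w)); rewrite -brD !addr0.
  elim=> [_ [v v' w|v w w'|c v w|c v w]||c y z _ IHy _ IHz].
  + by rewrite !linearB !fE brD addrAC addrK subrr.
  + by rewrite !linearB !fE blD addrAC addrK subrr.
  + by rewrite linearB linearZ !fE -[c *: v]addr0 br br0 addr0 subrr.
  + by rewrite linearB linearZ !fE -[c *: w]addr0 bl bl0 addr0 subrr.
  + exact: linear0.
  + by rewrite linearP IHy IHz scaler0 addr0.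
- by exists u => v w; rewrite uE fE.
Qed.

Lemma tensorP v : linear (tensor v : W -> tensor_space V W).
Proof.
move=> c w w'; transitivity (tensor v (c *: w) + tensor v w').
  apply/subr0_eq; rewrite opprD addrA -!linearB /=.
  rewrite -(linear0 (@quot_pi _ _ (@tensor_relator k V W))); apply/quot_eqP.
  by rewrite subr0; apply/asboolP/span_gen/tensor_addr.
congr (_ + _); rewrite /tensor -linearZ /=; apply/quot_eqP/asboolP/span_gen.
exact: tensor_scaler.
Qed.

Lemma tensorPl w : linear (fun v => tensor v w : tensor_space V W).
Proof.
move=> c v v'; transitivity (tensor (c *: v) w + tensor v' w).
  apply/subr0_eq; rewrite opprD addrA -!linearB /=.
  rewrite -(linear0 (@quot_pi _ _ (@tensor_relator k V W))); apply/quot_eqP.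
  by rewrite subr0; apply/asboolP/span_gen/tensor_addl.
congr (_ + _); rewrite /tensor -linearZ /=; apply/quot_eqP/asboolP/span_gen.
exact: tensor_scalel.
Qed.

(** No scalar clause appears because a multiple of a pure tensor is again pure. *)
Lemma tensor_ind (P : tensor_space V W -> Prop) :
  P 0 -> (forall t t', P t -> P t' -> P (t + t')) ->
  (forall v w, P (tensor v w)) -> forall t, P t.
Proof.
move=> P0 PD Pt t; rewrite -[t]quot_reprK.
elim/(@free_ind k (V * W)%type): (quot_repr t) => [|a b Pa Pb|[v w] c].
- by rewrite linear0.
- by rewrite linearD; apply: PD.
have -> : quot_pi (<< c *g (v, w) >> : free_module k (V * W)%type) =
    tensor (c *: v) w :> tensor_space V W.
  have := tensorPl w c v 0; rewrite !addr0.
  have -> : tensor 0 w = 0 :> tensor_space V W.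
    by have := tensorPl w (-1) 0 0; rewrite scaler0 addr0 scaleN1r addNr.
  by rewrite addr0 => ->; rewrite free_genE linearZ.
exact: Pt.
Qed.

End TensorLift.

Section HomRep.
Context {k : comPzRingType} {G : groupType} (W V : rep k G).

Lemma hom_act_subproof (g : G) (f : hom_space W V) :
  (fun w => rep_act g (f (rep_act g^-1%g w))) \in @linear_pred k W V.
Proof.
by apply/asboolP => c x y; rewrite rep_linear hom_fun_linear rep_linear.
Qed.

Definition hom_act g f : hom_space W V := HomSpace (hom_act_subproof g f).

Lemma hom_act_linear g : linear (hom_act g).
Proof. by move=> c f f'; apply: hom_spaceP => w; apply: rep_linear. Qed.

Lemma hom_act1 f : hom_act 1%g f = f.
Proof. by apply: hom_spaceP => w; rewrite /= invg1 !rep_act1. Qed.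

Lemma hom_actM g h f : hom_act (g * h)%g f = hom_act g (hom_act h f).
Proof. by apply: hom_spaceP => w; rewrite /= invgM !rep_actM. Qed.

Definition hom_rep : rep k G := Rep hom_act_linear hom_act1 hom_actM.

End HomRep.

Section RepModuleTheory.
Context {k : comPzRingType} {G : groupType}.
Local Notation kG := (group_ring k G).

(** Scalars and group elements generate the group ring. *)
Lemma group_ring_linear (M N : lmodType kG) (f : M -> N) :
  {morph f : x y / x + y} ->
  (forall c x, f ((gr_scalar c : kG) *: x) = (gr_scalar c : kG) *: f x) ->
  (forall g x, f ((gr_elt g : kG) *: x) = (gr_elt g : kG) *: f x) ->
  linear f.
Proof.
move=> fD fk fG a x y; rewrite fD; congr (_ + _).
elim/(@gr_ind k G): a x {y} => [|a b IHa IHb|g u] x.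
- by rewrite !scale0r (morphD0 fD).
- by rewrite !scalerDl fD IHa IHb.
have -> : << u *g g >> = (gr_scalar u : kG) * gr_elt g.
  by rewrite [RHS]gr_mulU mulr1 mul1g.
by rewrite -!scalerA fk fG.
Qed.

Lemma rep_module_scalar (V : rep k G) c (x : V) :
  (gr_scalar c : kG) *: (x : rep_module V) = c *: x :> V.
Proof. by rewrite -[LHS]/(rep_scale _ _) rep_scaleU rep_act1. Qed.

Lemma rep_module_elt (V : rep k G) g (x : V) :
  (gr_elt g : kG) *: (x : rep_module V) = rep_act g x :> V.
Proof. by rewrite -[LHS]/(rep_scale _ _) rep_scaleU scale1r. Qed.

Lemma linear_scalar (M N : lmodType kG) (f : {linear M -> N}) c
  (x : module_rep M) : f (c *: x) = c *: (f x : module_rep N) :> module_rep N.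
Proof. by rewrite -[LHS]/(f ((gr_scalar c : kG) *: (x : M))) linearZ. Qed.

End RepModuleTheory.

Lemma mcoeff_scale (R : pzRingType) (X : choiceType) (c : R) (a : free_module R X) x :
  (c *: a)@_x = c * a@_x.
Proof.
elim/(@free_ind R X): a => [|a b IHa IHb|y u].
- by rewrite scaler0 mcoeff0 mulr0.
- by rewrite scalerDr !mcoeffD IHa IHb mulrDr.
- by rewrite scale_malgU !mcoeffU mulrnAr.
Qed.

Section Adjunction.
Context {k : comPzRingType} {G : groupType} (W : rep k G).
Local Notation kG := (group_ring k G).
Implicit Types (M N E F K C P : lmodType kG).

Definition tensor_by M : lmodType kG := rep_module (tensor_rep (module_rep M) W).
Definition hom_from N : lmodType kG := rep_module (hom_rep W (module_rep N)).

Definition tens M (x : M) (w : W) : tensor_by M := tensor (x : module_rep M) w.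
Definition happ N (f : hom_from N) (w : W) : N :=
  hom_fun (f : hom_space W (module_rep N)) w.

Lemma hom_fromP N (f f' : hom_from N) : happ f =1 happ f' -> f = f'.
Proof. exact: (@hom_spaceP k W (module_rep N)). Qed.

Lemma happ_linear N (f : hom_from N) : linear (happ f : W -> module_rep N).
Proof. exact: hom_fun_linear. Qed.

Lemma happD N (f f' : hom_from N) w :
  happ (f + f') w = happ f w + happ f' w.
Proof. by []. Qed.

Lemma happ_elt N g (f : hom_from N) w :
  happ ((gr_elt g : kG) *: f) w = (gr_elt g : kG) *: happ f (rep_act g^-1%g w).
Proof. by rewrite rep_module_elt. Qed.

Lemma happ_scalar N c (f : hom_from N) w :
  happ ((gr_scalar c : kG) *: f) w = (gr_scalar c : kG) *: happ f w.
Proof. by rewrite rep_module_scalar. Qed.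

Lemma tens_elt M g (x : M) w :
  (gr_elt g : kG) *: tens x w = tens ((gr_elt g : kG) *: x) (rep_act g w).
Proof. by rewrite rep_module_elt; apply: diag_act_tensor. Qed.

Lemma tens_linear M (x : M) : linear (tens x : W -> module_rep (tensor_by M)).
Proof.
move=> c w w'; rewrite /tens [LHS]tensorP; congr (_ + _).
by rewrite -[RHS]/((gr_scalar c : kG) *: tens x w) rep_module_scalar.
Qed.

Lemma tensDl M w (x y : M) : tens (x + y) w = tens x w + tens y w.
Proof.
have E := @tensorPl k (module_rep M) W w 1 x y.
by rewrite !scale1r in E; exact: E.
Qed.

Lemma tens0l M w : tens (0 : M) w = 0.
Proof. exact: (morphD0 (tensDl w)). Qed.

Lemma tens_scalarl M w c (x : M) :
  tens ((gr_scalar c : kG) *: x) w = (gr_scalar c : kG) *: tens x w.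
Proof.
have E := @tensorPl k (module_rep M) W w c x 0.
have t0 : tensor (0 : module_rep M) w = 0 := tens0l M w.
by rewrite t0 !addr0 in E; rewrite rep_module_scalar; exact: E.
Qed.

Lemma tens_ind M (Q : tensor_by M -> Prop) :
  Q 0 -> (forall t t', Q t -> Q t' -> Q (t + t')) ->
  (forall x w, Q (tens x w)) -> forall t, Q t.
Proof. exact: tensor_ind. Qed.

Lemma tens_ext M N (u u' : {linear tensor_by M -> N}) :
  (forall x w, u (tens x w) = u' (tens x w)) -> u =1 u'.
Proof.
move=> uu'; elim/tens_ind => [|t t' IH IH'|//]; first by rewrite !linear0.
by rewrite !linearD IH IH'.
Qed.

(** Equivariance rests on [g x (x) w = g (x (x) g^-1 w)], which accounts for the conjugation action
    on Hom. *)
Lemma curry M N (u : {linear tensor_by M -> N}) :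
  exists f : {linear M -> hom_from N}, forall x w, happ (f x) w = u (tens x w).
Proof.
have u_lin (x : M) : (fun w => u (tens x w) : module_rep N) \in
    @linear_pred k W (module_rep N).
  apply/asboolP => c w w'; rewrite tens_linear linearD; congr (_ + _).
  exact: linear_scalar.
pose f (x : M) : hom_from N := HomSpace (u_lin x).
have [|h hE] := linear_map (f := f); last by exists h => x w; rewrite hE.
apply: group_ring_linear => [x y|c x|g x]; apply: hom_fromP => w.
- rewrite happD -[RHS]linearD.
  by congr (u _); apply: tensDl.
- rewrite happ_scalar -[RHS]linearZ; congr (u _).
  exact: tens_scalarl.
- rewrite happ_elt -[RHS]linearZ; congr (u _).
  by rewrite tens_elt -rep_actM mulgV rep_act1.
Qed.

(** The universal property yields a [k]-linear map; equivariance is then checked on pure tensors. *)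
Lemma uncurry M N (f : {linear M -> hom_from N}) :
  exists u : {linear tensor_by M -> N}, forall x w, u (tens x w) = happ (f x) w.
Proof.
have [//||u uE] := @tensor_lift k (module_rep M) W (module_rep N)
  (fun x w => happ (f x) w).
- by move=> x; apply: happ_linear.
- move=> w c x y /=.
  rewrite -[f _]/(f ((gr_scalar c : kG) *: (x : M) + y)) linearP happD.
  by rewrite happ_scalar.
have [v [vD vZ vE]] : exists v : tensor_by M -> N,
    [/\ {morph v : t t' / t + t'},
        forall c t, v ((gr_scalar c : kG) *: t) = (gr_scalar c : kG) *: v t &
        forall x w, v (tens x w) = happ (f x) w].
  exists u; split=> [t t'|c t|x w]; [exact: linearD| |exact: uE].
  by rewrite rep_module_scalar [LHS]linearZ.
have [|h hE] := @linear_map kG (tensor_by M) N v; last by exists h => x w; rewrite hE.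
apply: group_ring_linear => // g t.
elim/tens_ind: t => [|t t' IH IH'|x w].
- by rewrite scaler0 (morphD0 vD) scaler0.
- rewrite (scalerDr (gr_elt g : kG) t t'); apply: etrans (vD _ _) _.
  apply: etrans (congr2 +%R IH IH') _.
  by apply: etrans (esym (scalerDr (gr_elt g : kG) _ _)) _; rewrite -vD.
by rewrite tens_elt !vE linearZ happ_elt -rep_actM mulVg rep_act1.
Qed.

(** Functoriality comes from the unit of the adjunction. *)
Lemma tensor_map M N (f : {linear M -> N}) :
  exists u : {linear tensor_by M -> tensor_by N},
    forall x w, u (tens x w) = tens (f x) w.
Proof.
have [g gE] := curry (idfun : {linear tensor_by N -> tensor_by N}).
have [u uE] := uncurry (g \o f).
by exists u => x w; rewrite uE /= gE.
Qed.

Lemma hom_map M N (f : {linear M -> N}) :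
  exists u : {linear hom_from M -> hom_from N},
    forall h w, happ (u h) w = f (happ h w).
Proof.
have [g gE] := uncurry (idfun : {linear hom_from M -> hom_from M}).
have [u uE] := curry (f \o g).
by exists u => h w; rewrite uE /= gE.
Qed.

Lemma hom_from_elt N (phi : {linear W -> module_rep N}) :
  exists h : hom_from N, forall w, happ h w = phi w.
Proof.
have phiP : (phi : W -> module_rep N) \in @linear_pred k W (module_rep N).
  by apply/asboolP; apply: linearP.
by exists (HomSpace phiP).
Qed.

(** Contraction along [phi]. It is recorded as additive only, since [phi] may fail to commute with
    [G]. *)
Lemma tensor_eval M (phi : {linear W -> k^o}) :
  exists2 e : tensor_by M -> M, {morph e : t t' / t + t'} &
    forall x w, e (tens x w) = (gr_scalar (phi w : k) : kG) *: x.
Proof.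
have [x a w w'|w a x y|e eE] := @tensor_lift k (module_rep M) W (module_rep M)
  (fun x w => (phi w : k) *: x).
- by rewrite linearP scalerDl scalerA.
- by rewrite scalerDr !scalerA mulrC.
by exists e => [t t'|x w]; [apply: linearD|apply: eE].
Qed.

Context (prW : projective_module W).

(** The elements of [hom_from N] are all the [k]-linear maps, so lifting them is projectivity of [W]
    over [k]. *)
Lemma hom_map_surj E N (p : {linear E -> N})
    (u : {linear hom_from E -> hom_from N}) :
  surj p -> (forall h w, happ (u h) w = p (happ h w)) -> surj u.
Proof.
move=> p_surj uE h.
have [pk pkE] : exists pk : {linear module_rep E -> module_rep N}, pk =1 p.
  apply: linear_map => c x y; rewrite linearD; congr (_ + _).
  exact: linear_scalar.
have [hk hkE] := linear_map (@happ_linear N h).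
have [|g gE] := prW (p := pk) hk.
  by move=> y; have [x <-] := p_surj y; exists x.
have [h' h'E] := hom_from_elt g.
exists h'; apply: hom_fromP => w.
by rewrite uE h'E -hkE -gE pkE.
Qed.

(** By adjunction, lifting from [tensor_by P] along [p] is lifting from [P] along the surjection
    that [p] induces on Hom. *)
Lemma tensor_projective P :
  projective_module P -> projective_module (tensor_by P).
Proof.
move=> prP E N p f p_surj.
have [u uE] := hom_map p.
have [g gE] := curry f.
have [h hE] := prP _ _ u g (hom_map_surj p_surj uE).
have [v vE] := uncurry h.
exists v; apply: (@tens_ext _ _ (p \o v) f) => x w.
by rewrite /= vE -uE hE gE.
Qed.

(* The elements of a projective module have coordinates with respect to a dual
   basis. *)
Lemma tensor_injective K F (i : {linear K -> F})
    (u : {linear tensor_by K -> tensor_by F}) :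
  injective i -> (forall x w, u (tens x w) = tens (i x) w) -> injective u.
Proof.
move=> i_inj uE.
(* A section of the free cover: the coordinates of [w] are the [(s w)@_c], indexed by elements [c]
   of [W] itself. *)
have [s sK] := prW (p := free_cover W) idfun (@free_cover_surj _ W).
have coord M : exists e : W -> tensor_by M -> M, forall c,
    {morph e c : t t' / t + t'} /\
    forall x w, e c (tens x w) = (gr_scalar (s w)@_c : kG) *: x.
  have /choice[e eP] (c : W) : exists e : tensor_by M -> M,
      {morph e : t t' / t + t'} /\
      forall x w, e (tens x w) = (gr_scalar (s w)@_c : kG) *: x.
    have [|phi phiE] := @linear_map k W k^o (fun w => (s w)@_c).
      by move=> a w w'; rewrite linearP mcoeffD mcoeff_scale.
    have [e eD eE] := tensor_eval M phi.
    by exists e; split=> // x w; rewrite eE phiE.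
  by exists e.
have [e eP] := coord K; have [e' e'P] := coord F.
(* Allowing every larger [D'] lets the supports of two summands be merged. *)
have tensE (t : tensor_by K) : exists D : {fset W}, forall D' : {fset W},
    (D `<=` D')%fset -> t = \sum_(c <- D') tens (e c t) c.
  elim/tens_ind: t => [|t t' [D DP] [D' D'P]|x w].
  - exists fset0 => D' _; rewrite big1_fset // => c _ _.
    by rewrite (morphD0 (eP c).1) tens0l.
  - exists (D `|` D')%fset => D2; rewrite fsubUset => /andP[DD2 D'D2].
    rewrite {1}(DP _ DD2) {1}(D'P _ D'D2) -big_split; apply: eq_bigr => c _.
    by rewrite (eP c).1 tensDl.
  exists (msupp (s w)) => D wD.
  transitivity (tens x (free_cover W (s w))); first by rewrite sK.
  rewrite /free_cover /= /free_lift (malg_liftw _ wD); last by move=> c; rewrite scale0r.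
  have [tx txE] := linear_map (tens_linear x).
  rewrite -txE linear_sum; apply: eq_bigr => c _.
  by rewrite linearZ txE (eP c).2 tens_scalarl.
(* Coordinates commute with [i] and [u], so an element killed by [u] has all its coordinates killed
   by [i]. *)
have eE c t : i (e c t) = e' c (u t).
  elim/tens_ind: t => [|t t' IH IH'|x w].
  - by rewrite (morphD0 (eP c).1) !linear0 (morphD0 (e'P c).1).
  - by rewrite (eP c).1 !linearD IH IH' (e'P c).1.
  - by rewrite (eP c).2 uE (e'P c).2 linearZ.
move=> t t' utt'; apply/subr0_eq.
have [D DP] := tensE (t - t'); rewrite (DP D (fsubset_refl D)).
rewrite big1_fset // => c _ _; rewrite [e c _](_ : _ = 0) ?tens0l //.
by apply: i_inj; rewrite eE linearB utt' subrr linear0 (morphD0 (e'P c).1).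
Qed.

End Adjunction.

(** * Cofibrant modules *)

Section Cofibrant.
Context {k : comPzRingType} {G : groupType} (W : rep k G).
Local Notation kG := (group_ring k G).
Implicit Types (M N E F K C P : lmodType kG).
Context (prW : projective_module W).

Let cof M : Prop := projective_module (tensor_by W M).

Lemma cof_intro C :
  (forall E N (p : {linear E -> N}) (u : {linear hom_from W E -> hom_from W N})
      (f : {linear C -> hom_from W N}),
    surj p -> (forall h w, happ (u h) w = p (happ h w)) ->
    exists g : {linear C -> hom_from W E}, forall x, u (g x) = f x) ->
  cof C.
Proof.
move=> lift E N p f p_surj.
have [u uE] := hom_map W p; have [f' f'E] := curry f.
have [g gE] := lift _ _ p u f' p_surj uE.
have [v vE] := uncurry g.
exists v; apply: (@tens_ext _ _ _ _ _ (p \o v) f) => x w.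
by rewrite /= vE -uE gE f'E.
Qed.

(* Maps to [hom_from W N], for [N] the cokernel of [i'], factor through [q]. *)
Lemma tensor_exact K F C (i : {linear K -> F}) (q : {linear F -> C})
    (i' : {linear tensor_by W K -> tensor_by W F})
    (q' : {linear tensor_by W F -> tensor_by W C}) :
  surj q -> (forall x, q x = 0 -> range i x) ->
  (forall x w, i' (tens x w) = tens (i x) w) ->
  (forall x w, q' (tens x w) = tens (q x) w) ->
  forall t, q' t = 0 -> range i' t.
Proof.
move=> q_surj qi i'E q'E.
pose pi : {linear tensor_by W F -> quot_module (range i')} := quot_pi.
have [g gE] := curry pi.
have [|c cE] := @factor_surj _ _ _ _ q g q_surj.
  move=> _ /qi[x _ <-]; apply: hom_fromP => w; rewrite gE -i'E.
  by apply/quot_range; exists (tens x w).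
have [v vE] := uncurry c.
move=> t t0; apply/quot_range; rewrite -[LHS]/(pi t).
have -> : pi t = v (q' t); last by rewrite t0 linear0.
by move: t {t0}; apply: (@tens_ext _ _ _ _ _ pi (v \o q')) => x w;
  rewrite /= q'E vE cE gE.
Qed.

(** The map [q'] induced by [q] splits by cofibrancy of [C]; subtracting the splitting projects onto
    the image of [i']. *)
Lemma tensor_split K F C (i : {linear K -> F}) (q : {linear F -> C})
    (i' : {linear tensor_by W K -> tensor_by W F}) :
  cof C -> injective i -> surj q -> (forall x, q x = 0 <-> range i x) ->
  (forall x w, i' (tens x w) = tens (i x) w) ->
  exists r : {linear tensor_by W F -> tensor_by W K}, cancel i' r.
Proof.
move=> cofC i_inj q_surj qi i'E.
have [q' q'E] := tensor_map W q.
have i'_inj := tensor_injective prW i_inj i'E.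
have q'_surj : surj q'.
  elim/(@tens_ind _ _ W C) => [|t t' [s <-] [s' <-]|x w].
    by exists 0; rewrite linear0.
    by exists (s + s'); rewrite linearD.
  by have [y <-] := q_surj x; exists (tens y w); rewrite q'E.
have [s sK] := cofC _ _ q' idfun q'_surj.
have qi0 t : q' (i' t) = 0.
  move: t; apply: (@tens_ext _ _ _ _ _ (q' \o i') \0) => x w.
  by rewrite /= i'E q'E (_ : q (i x) = 0) ?tens0l //; apply/qi; exists x.
have [|r rE] := @factor_inj _ _ _ _ i' (idfun \- (s \o q')) i'_inj.
  move=> t; apply: (tensor_exact q_surj _ i'E q'E) => [x /qi //|].
  by rewrite /= linearB sK subrr.
by exists r => t; apply: i'_inj; rewrite rE /= qi0 linear0 subr0.
Qed.

Lemma free_cover_kernel M x :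
  free_cover M x = 0 <-> range (val : kernel (free_cover M) -> _) x.
Proof.
split=> [/eqP x0|[y _ <-]]; first by exists (Kernel x0).
exact/eqP/kernelP.
Qed.

Lemma kernel_split C : cof C ->
  exists i' : {linear tensor_by W (kernel (free_cover C)) ->
                      tensor_by W (free_module kG C)},
  exists2 r : {linear tensor_by W (free_module kG C) ->
                      tensor_by W (kernel (free_cover C))},
    cancel i' r & forall x w, i' (tens x w) = tens (val x) w.
Proof.
move=> cofC.
have [i' i'E] := tensor_map W (val : kernel (free_cover C) -> free_module kG C).
have [r rK] := tensor_split cofC val_inj (@free_cover_surj _ C)
  (@free_cover_kernel C) i'E.
by exists i', r.
Qed.

Lemma cof_kernel C : cof C -> cof (kernel (free_cover C)).
Proof.
move=> /kernel_split[i' [r rK _]]; apply: retract_projective rK _.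
exact/(tensor_projective prW)/free_projective.
Qed.

Lemma cof_syzygy n C : cof C -> cof (syzygy n C).
Proof. by move=> cofC; elim: n => //= n; apply: cof_kernel. Qed.

(** Transpose a map out of the kernel, extend it along the retraction of [kernel_split], and
    transpose back. *)
Lemma right_perp_hom_from N : right_perp cof (hom_from W N).
Proof.
move=> C cofC; apply/Ext_vanishesP => /= h.
have [i' [r rK i'E]] := kernel_split cofC.
have [u uE] := uncurry h; have [g gE] := curry (u \o r).
exists g => x; apply: hom_fromP => w.
by rewrite gE /= -i'E rK uE.
Qed.

(** Hom from [W] turns [kernel p -> E -> N] into a short exact sequence whose first term is right
    orthogonal, so [Ext1_lift] gives the lifts required by [cof_intro]. *)
Lemma left_perp_cof M : left_perp (right_perp cof) M -> cof M.
Proof.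
move=> perpM; apply: cof_intro => E N p u f p_surj uE.
pose i : {linear kernel p -> E} := val.
have [i' i'E] := hom_map W i.
apply: (Ext1_lift f (perpM _ (@right_perp_hom_from (kernel p))) (i := i')).
- move=> h h' /(congr1 (@happ _ _ W E)) hh'; apply: hom_fromP => w.
  by apply: val_inj; have := congr1 (@^~ w) hh'; rewrite !i'E.
- exact: hom_map_surj prW _ _ _ _ p_surj uE.
move=> h; split=> [uh0|[h' _ <-]]; last first.
  by apply: hom_fromP => w; rewrite uE i'E; apply/eqP/kernelP.
have ph0 w : happ h w \in kerb p by apply/eqP; rewrite -uE uh0.
have [|phi phiE] := @linear_map k W (module_rep (kernel p)) (fun w => Kernel (ph0 w)).
  move=> c w w'; apply: val_inj => /=; rewrite happ_linear.
  have iP := linearP i (gr_scalar c : kG) (Kernel (ph0 w)) (Kernel (ph0 w')).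
  exact: esym iP.
have [h' h'E] := hom_from_elt phi.
by exists h' => //; apply: hom_fromP => w; rewrite i'E h'E phiE.
Qed.

Lemma hereditary_cof : hereditary cof (right_perp cof).
Proof.
move=> [//|n] _ M N cofM perpN; apply/Ext_vanishesP => h.
(* Dimension shifting: the extension criterion for [M] in degree [n.+1] is literally the one for
   [syzygy n M] in degree 1. *)
exact: (proj1 (Ext_vanishesP 0 _ N) (perpN _ (@cof_syzygy n M cofM)) h).
Qed.

(** * Consequences of an invariant unit, an augmentation and a multiplication on [W] *)

Context (one : W) (aug : {linear W -> k^o}) (mul : W -> W -> W).
Context (one_inv : forall g, rep_act g one = one).
Context (aug1 : aug one = 1).
Context (mul1 : forall a, mul one a = a).
Context (mul_linear : forall a, linear (mul a)).
Context (mul_linearl : forall b, linear (mul^~ b)).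
Context (mul_act : forall g a b, mul (rep_act g a) (rep_act g b) = rep_act g (mul a b)).

Lemma happ_one P : exists ev : {linear hom_from W P -> P}, forall h, ev h = happ h one.
Proof.
have [|ev evE] := @linear_map kG (hom_from W P) P (fun h => happ h one).
  apply: group_ring_linear => [h h'|c h|g h]; first exact: happD.
    exact: happ_scalar.
  by rewrite happ_elt one_inv.
by exists ev.
Qed.

Lemma projective_right_perp P : projective_module P -> right_perp cof P.
Proof.
move=> prP C cofC; apply/Ext_vanishesP => /= h.
have [ev evE] := happ_one P.
have [y|s sK] := prP _ _ ev idfun.
  (* Evaluation at [one] is onto: [y] is the value of [w |-> aug w *: y], since [aug one = 1]. *)
  have [|phi phiE] := @linear_map k W (module_rep P)
    (fun w => (aug w : k) *: (y : module_rep P)).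
    by move=> c w w'; rewrite linearP scalerDl scalerA.
  have [h' h'E] := hom_from_elt phi.
  exists h'; rewrite evE h'E phiE aug1; exact: scale1r.
have /Ext_vanishesP := @right_perp_hom_from P C cofC => /= /(_ (s \o h))[g gE].
by exists (ev \o g) => x; rewrite /= gE /= sK.
Qed.

(** Precomposition with [mul], in curried form; [mul_act] gives equivariance. *)
Lemma hom_mul N : exists mu : {linear hom_from W N -> hom_from W (hom_from W N)},
  forall h a b, happ (happ (mu h) a) b = happ h (mul a b).
Proof.
have inP (h : hom_from W N) a : (fun b => happ h (mul a b) : module_rep N) \in
    @linear_pred k W (module_rep N).
  by apply/asboolP => c b b'; rewrite mul_linear happ_linear.
pose m h a : hom_from W N := HomSpace (inP h a).
have mE h a b : happ (m h a) b = happ h (mul a b) by [].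
have outP h : (m h : W -> module_rep (hom_from W N)) \in
    @linear_pred k W (module_rep (hom_from W N)).
  apply/asboolP => c a a'; apply: hom_fromP => b.
  rewrite mE mul_linearl happ_linear happD; congr (_ + _).
  exact: esym (happ_scalar c (m h a) b).
pose mm h : hom_from W (hom_from W N) := HomSpace (outP h).
have mmE h a b : happ (happ (mm h) a) b = happ h (mul a b) by [].
have [|mu muE] := linear_map (f := mm); last by exists mu => h a b; rewrite muE.
apply: group_ring_linear => [h h'|c h|g h]; apply: hom_fromP => a;
  apply: hom_fromP => b.
- by rewrite !happD !mmE happD.
- by rewrite !happ_scalar !mmE happ_scalar.
- by rewrite !happ_elt !mmE happ_elt mul_act.
Qed.

(** Contraction along [aug] is an additive left inverse, whence injectivity. *)
Lemma tensor_one M : exists2 j : {linear M -> tensor_by W M},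
  forall x, j x = tens x one & injective j.
Proof.
have [|j jE] := @linear_map kG M (tensor_by W M) (fun x => tens x one).
  apply: group_ring_linear => [x y|c x|g x]; first exact: tensDl.
    exact: tens_scalarl.
  by rewrite tens_elt one_inv.
exists j => //; have [e eD eE] := tensor_eval M aug.
have ejK x : e (j x) = x by rewrite jE eE aug1; apply: scale1r.
exact: can_inj ejK.
Qed.

(* A lift [g] along [p] of a map on [tensor_by W M] is corrected by subtracting
   [x (x) a |-> (b |-> g (x (x) 1) (a b))], which makes it vanish on the image of
   [j] without changing its composite with [p]. *)
Lemma cof_cokernel M (j : {linear M -> tensor_by W M}) :
  (forall x, j x = tens x one) -> cof M -> cof (quot_module (range j)).
Proof.
move=> jE cofM; apply: cof_intro => E N p u f p_surj uE.
pose pi : {linear tensor_by W M -> quot_module (range j)} := quot_pi.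
have [g gE] := cofM _ _ u (f \o pi) (hom_map_surj prW p_surj uE).
have [mu muE] := hom_mul E.
have [m mE] := uncurry (mu \o (g \o j)).
have pi_surj : surj pi by move=> c; exists (quot_repr c); apply: quot_reprK.
have [|c cE] := @factor_surj _ _ _ _ pi (g \- m) pi_surj.
  move=> t /quot_range[x _ <-]; apply: hom_fromP => b.
  rewrite /= {2}jE mE /= (_ : happ (mu (g (j x))) one = g (j x)) ?subrr //.
  by apply: hom_fromP => b'; rewrite muE mul1.
exists c => y; have [t <-] := pi_surj y.
rewrite cE /= linearB gE /= -[RHS]subr0; congr (_ - _).
move: t; apply: (@tens_ext _ _ _ _ _ (u \o m) \0) => x a.
apply: hom_fromP => b; rewrite /= mE /= uE muE -uE gE /=.
rewrite (_ : pi (j x) = 0) ?linear0 //.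
by apply/quot_range; exists x.
Qed.

Lemma cof_perp_projective M : cof M -> right_perp cof M -> projective_module M.
Proof.
move=> cofM perpM; have [j jE j_inj] := tensor_one M.
pose pi : {linear tensor_by W M -> quot_module (range j)} := quot_pi.
have pi_surj : surj pi by move=> c; exists (quot_repr c); apply: quot_reprK.
(* Orthogonality to the cofibrant cokernel gives a section of [pi], so [M] is a retract of
   [tensor_by W M]. *)
have [s sK] := Ext1_lift idfun (perpM _ (cof_cokernel jE cofM)) j_inj pi_surj
  (@quot_range _ _ _ j).
have pij x : pi (j x) = 0 by apply/quot_range; exists x.
have [|r rE] := @factor_inj _ _ _ _ j (idfun \- (s \o pi)) j_inj.
  by move=> t; apply/quot_range; rewrite -[LHS]/(pi _) linearB /= sK subrr.
apply: (@retract_projective _ _ _ j r) cofM => x; apply: j_inj.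
by rewrite rE /= pij linear0 subr0.
Qed.

End Cofibrant.

(** * The algebra of finite-valued functions *)

Section FinvalAlgebra.
Context {k : comPzRingType} {G : groupType}.
Local Notation B := (@finval_rep k G).
Local Notation fval := (fun f : B => (f : {fimfun G >-> k}) : G -> k).

Lemma finval_mul_subproof (f f' : B) :
  (fun x => fval f x * fval f' x) \in @fimfun G k.
Proof. by apply: mem_set; apply: finite_image11; apply: fimfunP. Qed.

Definition finval_mul (f f' : B) : B := fimfun_Sub (finval_mul_subproof f f').

Definition finval_one : B := cst_fimfun (1 : k).

Lemma finvalP (f f' : B) : fval f =1 fval f' -> f = f'.
Proof. by move=> ff'; apply/fimfuneqP. Qed.

Lemma finval_aug : exists aug : {linear B -> k^o}, forall f, aug f = fval f 1%g.
Proof. by apply: (@linear_map k B k^o (fun f => fval f 1%g)). Qed.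

End FinvalAlgebra.

Theorem proposition3p3 (k : comPzRingType) (G : groupType) :
  cotorsion_pair (cofibrant k G) (right_perp (cofibrant k G)) /\
  hereditary (cofibrant k G) (right_perp (cofibrant k G)) /\
  projective_pair (cofibrant k G) (right_perp (cofibrant k G)).
Proof.
(* [cofibrant] tensors with [W], the translation of [B] to a [kG]-module and back. It has the
   elements of [B], but its scaling and action agree with those of [B] only through [idZ] and
   [actE]. *)
pose B := @finval_rep k G; pose W := module_rep (B_module G k).
have idZ c (f : W) : c *: f = c *: (f : B) :> B by apply: rep_module_scalar.
have actE g (f : W) : rep_act g f = rep_act g (f : B) :> B by apply: rep_module_elt.
have [to toE] : exists to : {linear B -> W}, forall f, to f = f.
  by apply: (@linear_map k B W id) => c f f'; rewrite idZ.
have [from fromE] : exists from : {linear W -> B}, forall f, from f = f.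
  by apply: (@linear_map k W B id) => c f f'; rewrite idZ.
have prW : projective_module W.
  apply: (@retract_projective _ _ _ from to); last exact: finval_projective.
  by move=> f; rewrite fromE toE.
have [aug augE] := @finval_aug k G.
pose one : W := @finval_one k G.
pose mul (f f' : W) : W := finval_mul f f'.
have one_inv g : rep_act g one = one.
  by rewrite actE; apply: finvalP.
have aug1 : (aug \o from) one = 1 by rewrite /= fromE augE.
have mul1 f : mul one f = f by apply: finvalP => x /=; rewrite mul1r.
have mul_lin f : linear (mul f).
  move=> c f1 f2; rewrite !idZ; apply: finvalP => x /=.
  by rewrite mulrDr mulrCA.
have mul_linl f : linear (mul^~ f).
  move=> c f1 f2; rewrite !idZ; apply: finvalP => x /=.
  by rewrite mulrDl; congr (_ + _); apply/esym/mulrA.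
have mul_act g f1 f2 : mul (rep_act g f1) (rep_act g f2) = rep_act g (mul f1 f2).
  by rewrite !actE; apply: finvalP.
split; last split.
- split=> [M|//]; split=> [cofM N perpN|]; first exact: perpN.
  exact: (left_perp_cof prW).
- exact: (hereditary_cof prW).
move=> M; split=> [[]|prM].
  exact: (cof_perp_projective prW one_inv aug1 mul1 mul_lin mul_linl mul_act).
split; first exact: (tensor_projective prW prM).
exact: (projective_right_perp prW one_inv aug1 prM).
Qed.
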